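(* Let $D$ be an integral domain and $\star$ a semistar operation on $D$. Then $$\widetilde{\star}\text{-}\dim_v(D)=\dim_v(\operatorname{Na}(D,\star)).$$
   Context: For a domain $D$ with quotient field $K$, $\overline{\mathcal F}(D)$ is the set of nonzero $D$-submodules of $K$ and $f(D)$ the set of nonzero finitely generated $D$-submodules of $K$. A semistar operation on $D$ is a map $\star:\overline{\mathcal F}(D)\to\overline{\mathcal F}(D)$, $E\mapsto E^\star$, such that for all $0\ne x\in K$ and $E,F\in\overline{\mathcal F}(D)$: $(xE)^\star=xE^\star$; $E\subseteq F$ implies $E^\star\subseteq F^\star$; $E\subseteq E^\star=(E^\star)^\star$. Define $E^{\star_f}:=\bigcup\{F^\star\mid F\in f(D),F\subseteq E\}$. A nonzero ideal $I$ of $D$ is a quasi-$\star$-ideal if $I^\star\cap D=I$; $\operatorname{QMax}^{\star}(D)$ is the set of maximal elements of the set of proper quasi-$\star$-ideals (they are prime). $\widetilde\star$ is the semistar operation $E^{\widetilde\star}:=\bigcap\{ED_P\mid P\in\operatorname{QMax}^{\star_f}(D)\}$ (equal to $K$ if $\operatorname{QMax}^{\star_f}(D)=\emptyset$). A valuation overring $V$ of $D$, i.e. a valuation domain with $D\subseteq V\subseteq K$ ($V=K$ allowed, of dimension $0$), is a $\star$-valuation overring if $F^\star\subseteq FV$ for each $F\in f(D)$. $\star\text{-}\dim_v(D)=n$ means every $\star$-valuation overring of $D$ has dimension at most $n$ and some $\star$-valuation overring has dimension $n$; if no such integer exists, $\star\text{-}\dim_v(D)=\infty$. For a domain $R$,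 $\dim_v(R)$ is the classical valuative dimension: the supremum of the dimensions of the valuation overrings of $R$. The $\star$-Nagata domain is $\operatorname{Na}(D,\star):=D[X]_{N_\star}$, where $N_\star:=\{g\in D[X]\mid g\ne0,\ c_D(g)^\star=D^\star\}$ and $c_D(g)$ is the ideal of $D$ generated by the coefficients of $g$. *)

(* Defs.v *)
From HB Require Import structures.
From mathcomp Require Import all_boot all_order all_algebra.
From mathcomp Require Import boolp classical_sets constructive_ereal.

Set Implicit Arguments.
Unset Strict Implicit.
Unset Printing Implicit Defensive.

Import Order.TTheory GRing.Theory Num.Theory.

Local Open Scope classical_set_scope.
Local Open Scope ring_scope.

(* All rings below are subrings, given as sets, of an ambient field L;
   a domain D : idomainType is identified with its image in {fraction D}. *)

Section Subrings.
Variable L : fieldType.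
Implicit Types (R V A B E F I P : set L).

Definition nonzero E : Prop := exists2 x, E x & x != 0.

Definition is_subring R : Prop := subring_closed [in R].

Definition submodule R E : Prop :=
  [/\ E 0,
      forall x y, E x -> E y -> E (x + y)
    & forall r x, R r -> E x -> E (r * x)].

Definition ideal R I : Prop := submodule R I /\ I `<=` R.

Definition prime_ideal R P : Prop :=
  [/\ ideal R P, P != R
    & forall x y, R x -> R y -> P (x * y) -> P x \/ P y].

Definition span R n (g : 'I_n -> L) : set L :=
  [set x | exists2 a : 'I_n -> L, (forall i, R (a i)) & x = \sum_(i < n) a i * g i].

Definition fin_gen R E : Prop := exists n (g : 'I_n -> L), E = span R g.

(* AB: the finite sums of products, not merely the set of products. *)
Definition mulmod A B : set L :=
  [set x | exists n (a b : 'I_n -> L),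
    [/\ forall i, A (a i), forall i, B (b i) & x = \sum_(i < n) a i * b i]].

Definition localization R P : set L :=
  [set a / s | a in R & s in R `\` P].

Definition quotient_field R : set L :=
  [set a / b | a in R & b in R `\ 0].

Definition valuation_domain V : Prop :=
  is_subring V /\
  forall x, quotient_field V x -> x != 0 -> V x \/ V x^-1.

Definition valuation_overring R V : Prop :=
  [/\ valuation_domain V, R `<=` V & V `<=` quotient_field R].

(* Dimensions are elements of N u {oo}, seen inside \bar int. *)
Definition dim_of_nat (n : nat) : \bar int := (n%:Z)%:E%E.

Definition prime_chain R (n : nat) : Prop :=
  exists P : nat -> set L,
    (forall i, (i <= n)%N -> prime_ideal R (P i)) /\
    (forall i, (i < n)%N -> P i `<` P i.+1).

Definition krull_dim R : \bar int :=
  supremum 0%E [set dim_of_nat n | n in prime_chain R].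

Definition valuative_dim R : \bar int :=
  supremum 0%E [set krull_dim V | V in valuation_overring R].

End Subrings.

Section Semistar.
Variable D : idomainType.
Notation K := {fraction D}.

Definition dom : set K := range (@tofrac D).

Definition Fbar : set (set K) := [set E | submodule dom E /\ nonzero E].

Definition fD : set (set K) := [set F | Fbar F /\ fin_gen dom F].

(* A semistar operation is a map Fbar -> Fbar; it is represented by a map on
   all subsets of K, whose values outside Fbar are irrelevant. *)
Definition semistar (star : set K -> set K) : Prop :=
  [/\ forall E, Fbar E -> Fbar (star E),
      forall x E, x != 0 -> Fbar E ->
        star [set x * y | y in E] = [set x * y | y in star E],
      forall E F, Fbar E -> Fbar F -> E `<=` F -> star E `<=` star F,
      forall E, Fbar E -> E `<=` star E
    & forall E, Fbar E -> star (star E) = star E].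

Variable star : set K -> set K.

Definition star_f (E : set K) : set K :=
  \bigcup_(F in [set F | fD F /\ F `<=` E]) star F.

Definition quasi_star_ideal (I : set K) : Prop :=
  [/\ ideal dom I, nonzero I & star I `&` dom = I].

Definition proper_quasi_star_ideal (I : set K) : Prop :=
  quasi_star_ideal I /\ I != dom.

Definition QMax : set (set K) :=
  [set P | proper_quasi_star_ideal P /\
     forall J, proper_quasi_star_ideal J -> P `<=` J -> J = P].

Definition star_valuation_overring (V : set K) : Prop :=
  valuation_overring dom V /\ forall F, fD F -> star F `<=` mulmod F V.

Definition star_dimv_eq (n : nat) : Prop :=
  (forall V, star_valuation_overring V -> (krull_dim V <= dim_of_nat n)%E) /\
  (exists2 V, star_valuation_overring V & krull_dim V = dim_of_nat n).

Definition star_dimv : \bar int :=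
  xget +oo%E [set dim_of_nat n | n in star_dimv_eq].

Definition content (g : {poly D}) : set K :=
  span dom (fun i : 'I_(size g) => tofrac g`_i).

Definition N_star : set {poly D} :=
  [set g | g != 0 /\ star (content g) = star dom].

Definition Na : set {fraction {poly D}} :=
  [set tofrac f / tofrac g | f in [set: {poly D}] & g in N_star].

End Semistar.

(* The empty intersection is the whole of K. *)
Definition star_tilde (D : idomainType) (star : set {fraction D} -> set {fraction D})
    (E : set {fraction D}) : set {fraction D} :=
  \bigcap_(P in QMax (star_f star)) mulmod E (localization (@dom D) P).

(* Main.v *)
(** A valuation overring [V] of [D] is a valuation overring for the tilde operation
as soon as it contains [D_P] for some [P] in [QMax] of the finite-type operation;
conversely, for such a [V] every [g] in [N_star] has a coefficient which is a unit of
[V].  Hence the Gauss extension of [V] to [K(X)] contains the Nagata ring, and its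
primes include the extensions of those of [V].

Conversely let [W] be a valuation overring of the Nagata ring, with maximal ideal [M].
The coefficients of the polynomials in the intersection of [M] with [D[X]] form an ideal
of [D] contained in some [P] as above, so [X] is not integral over [D_P + M].  By
Chevalley there is a valuation ring [U] of [K(X)] containing [D_P + M] and not [X];
it is strictly smaller than [W] and so has longer chains of primes.  As [K(X)] has
transcendence degree one, restricting [U] to [K] merges at most one pair of consecutive
primes, so the restriction contains [D_P] and has chains at least as long as those of
[W]. *)
From HB Require Import structures.
Require Import Defs.
From mathcomp Require Import all_boot all_order all_algebra.
From mathcomp Require Import boolp classical_sets constructive_ereal.
From mathcomp Require Import generic_quotient fraction.
From mathcomp Require Import ring zify.

Set Implicit Arguments.
Unset Strict Implicit.
Unset Printing Implicit Defensive.

Import Order.TTheory GRing.Theory Num.Theory.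

Local Open Scope classical_set_scope.
Local Open Scope ring_scope.
Local Open Scope quotient_scope.

(** * Closure properties of subrings and submodules *)

Section SubringTheory.
Variables (L : fieldType) (R : set L).
Hypothesis hR : is_subring R.

Lemma subring1 : R 1.
Proof. by case: hR; rewrite inE. Qed.

Lemma subringB x y : R x -> R y -> R (x - y).
Proof. by case: hR => _ + _ => /(_ x y); rewrite !inE; apply. Qed.

Lemma subringM x y : R x -> R y -> R (x * y).
Proof. by case: hR => _ _ /(_ x y); rewrite !inE; apply. Qed.

Lemma subring0 : R 0.
Proof. by rewrite -(subrr 1); apply: subringB subring1 subring1. Qed.

Lemma subringN x : R x -> R (- x).
Proof. by rewrite -sub0r; apply: subringB subring0. Qed.

Lemma subringD x y : R x -> R y -> R (x + y).
Proof. by move=> Rx Ry; rewrite -[y]opprK; apply: subringB Rx (subringN Ry). Qed.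

Lemma subringX x n : R x -> R (x ^+ n).
Proof.
move=> Rx; elim: n => [|n IH]; first by rewrite expr0; apply: subring1.
by rewrite exprS; apply: subringM.
Qed.

Lemma subring_submodule : submodule R R.
Proof. by split; [apply: subring0|apply: subringD|move=> r x; apply: subringM]. Qed.

End SubringTheory.

Lemma submodule_sum (L : fieldType) (R E : set L) (I : finType) (P : pred I) (F : I -> L) :
  submodule R E -> (forall i, E (F i)) -> E (\sum_(i | P i) F i).
Proof. by case=> E0 ED _ EF; elim/big_ind: _ => // i _; apply: EF. Qed.

Lemma subring_sum (L : fieldType) (R : set L) (I : finType) (P : pred I) (F : I -> L) :
  is_subring R -> (forall i, R (F i)) -> R (\sum_(i | P i) F i).
Proof. by move=> hR; apply: submodule_sum; apply: subring_submodule. Qed.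

Lemma is_subringP (L : fieldType) (R : set L) :
  R 1 -> (forall x y, R x -> R y -> R (x - y)) ->
  (forall x y, R x -> R y -> R (x * y)) -> is_subring R.
Proof.
move=> R1 RB RM; split => [|x y|x y]; rewrite !inE; [exact: R1|exact: RB|exact: RM].
Qed.

(** * Polynomials with prescribed coefficients and rings generated by one element *)

Definition coefs_in (A : nzRingType) (R : set A) (f : {poly A}) : Prop := forall i, R f`_i.

Section Adjoin.
Variables (L : fieldType) (R : set L).
Hypothesis hR : is_subring R.

Definition adjoin (y : L) : set L := [set f.[y] | f in coefs_in R].

Lemma coefs_inC c : R c -> coefs_in R c%:P.
Proof. by move=> Rc i; rewrite coefC; case: ifP => // _; apply: subring0. Qed.

Lemma coefs_inX : coefs_in R 'X.
Proof. by move=> i; rewrite coefX; case: (_ == _); [apply: subring1|apply: subring0]. Qed.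

Lemma coefs_inB f g : coefs_in R f -> coefs_in R g -> coefs_in R (f - g).
Proof. by move=> Rf Rg i; rewrite coefB; apply: subringB. Qed.

Lemma coefs_inM f g : coefs_in R f -> coefs_in R g -> coefs_in R (f * g).
Proof.
move=> Rf Rg i; rewrite coefM; apply: subring_sum => // j.
exact: subringM.
Qed.

Lemma adjoin_subring y : is_subring (adjoin y).
Proof.
apply: is_subringP => [|_ _ [f Rf <-] [g Rg <-]|_ _ [f Rf <-] [g Rg <-]].
- exists 1%:P; last by rewrite hornerC.
  by apply: coefs_inC; apply: subring1.
- by exists (f - g); [apply: coefs_inB|rewrite !hornerE].
- by exists (f * g); [apply: coefs_inM|rewrite !hornerE].
Qed.

Lemma sub_adjoin y : R `<=` adjoin y.
Proof. by move=> c Rc; exists c%:P; [apply: coefs_inC|rewrite hornerC]. Qed.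

Lemma mem_adjoin y : adjoin y y.
Proof. by exists 'X; [apply: coefs_inX|rewrite hornerX]. Qed.

(** The factor [y ^+ n] turns each power of [y^-1] into a nonnegative power of [y]. *)
Lemma horner_inv_mul n y f : coefs_in R f -> R y -> y != 0 -> (size f <= n)%N ->
  R (y ^+ n * f.[y^-1]).
Proof.
move=> Rf Ry y0 le_fn; rewrite (horner_coef_wide _ le_fn) mulr_sumr.
apply: subring_sum => // i; rewrite mulrCA exprVn -expfB_cond ?(negbTE y0) ?(leq_trans (ltnW (ltn_ord i))) //.
by apply: subringM => //; apply: subringX.
Qed.

End Adjoin.

(** The dichotomy ranges over the whole field [L], not over [quotient_field V] as in
    [valuation_domain]; for overrings of [dom] or of the Nagata ring the two agree. At 0 it is
    harmless, as [0^-1 = 0]. *)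
Definition valring (L : fieldType) (V : set L) : Prop :=
  is_subring V /\ forall x, V x \/ V x^-1.

(** * Chevalley's extension theorem *)

Section Chevalley.
Variables (L : fieldType) (U : set L) (z : L).
Hypotheses (hU : is_subring U) (Uz : U z) (UNz : ~ U z^-1).
Hypothesis maxU : forall y, ~ U y -> adjoin U y z^-1.

Let z0 : z != 0.
Proof. by apply/eqP => z0; apply: UNz; rewrite z0 invr0; apply: subring0. Qed.

Let zU : set L := [set z * u | u in U].

(** Otherwise maximality gives [z^-1 = f(e^-1)] with [e = 1 - z * u]. A power of [e] clears the
    denominators and is congruent to 1 modulo [z U], which forces [z^-1] into [U]. *)
Lemma maximal_one_sub_unit u : U u -> U (1 - z * u)^-1.
Proof.
move=> Uu; set e := 1 - z * u; apply: contrapT => Ne.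
have Ue : U e by apply: subringB => //; [apply: subring1|apply: subringM].
have e0 : e != 0 by apply/eqP => e0; apply: Ne; rewrite e0 invr0; apply: subring0.
have [f Uf fe] := maxU Ne.
have [c Uc ec] : exists2 c, U c & e ^+ size f = 1 - z * c.
  elim: (size f) => [|n [c Uc IH]].
    by exists 0; [apply: subring0|rewrite mulr0 subr0].
  exists (c + u - z * c * u); last by rewrite exprS IH /e; ring.
  apply: subringB => //; first exact: subringD.
  by apply: subringM => //; apply: subringM.
have := horner_inv_mul hU Uf Ue e0 (leqnn _).
rewrite fe ec mulrBl mul1r mulrAC mulfV // mul1r => Uzc.
by apply: UNz; rewrite -[z^-1](subrK c); apply: subringD.
Qed.

Let zUN1 : ~ zU 1.
Proof.
by case=> u Uu zu; apply: UNz; rewrite -[z^-1]mulr1 -zu mulKf.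
Qed.

Let zUD a b : zU a -> zU b -> zU (a + b).
Proof.
by move=> [u Uu <-] [v Uv <-]; exists (u + v); [apply: subringD|rewrite mulrDr].
Qed.

Let zUM a b : U a -> zU b -> zU (a * b).
Proof.
by move=> Ua [v Uv <-]; exists (a * v); [apply: subringM|rewrite mulrCA].
Qed.

Let zU_U a : zU a -> U a.
Proof. by case=> u Uu <-; apply: subringM. Qed.

(* A relation of least degree among [1 = f(y)] and [1 = g(1/y)] with coefficients
   in [zU] can be shortened by the other one. *)
Lemma maximal_no_two_relations n (f g : {poly L}) y : y != 0 ->
  (size f + size g <= n)%N -> coefs_in zU f -> coefs_in zU g ->
  f.[y] = 1 -> g.[y^-1] = 1 -> False.
Proof.
elim: n f g y => [|n IH] f g y y0 le_n zf zg fy gy.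
  move: le_n; rewrite leqn0 addn_eq0 size_poly_eq0 => /andP[/eqP f0 _].
  by move/eqP: fy; rewrite f0 horner0 eq_sym oner_eq0.
(* Replacing [y] by [y^-1] exchanges the two relations. *)
wlog le_gf : f g y y0 le_n zf zg fy gy / (size g <= size f)%N.
  move=> wlog_gf; case: (leqP (size g) (size f)) => [|/ltnW] le_gf.
    exact: (wlog_gf f g y).
  apply: (wlog_gf g f y^-1) => //; first by rewrite invr_eq0.
    by rewrite addnC.
  by rewrite invrK.
have g_gt1 : (1 < size g)%N.
  rewrite ltnNge; apply/negP => /size1_polyC gC.
  by apply: zUN1; rewrite -gy gC hornerC.
have [u Uu g0u] := zg 0%N.
set e := 1 - g`_0.
have Ue1 : U e^-1 by rewrite /e -g0u; apply: maximal_one_sub_unit.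
have e0 : e != 0.
  by apply/eqP => /subr0_eq e0; apply: zUN1; rewrite e0.
case def_m: (size f) => [|m]; first by move: le_gf g_gt1; lia.
(* The constant term of [1 = g(1/y)] is moved to the left, where it forms the unit [e];
   multiplication by [y ^+ m] then expresses [y ^+ m] through lower powers with coefficients in
   [zU]. *)
have sum_g : \sum_(i < m) g`_(m - i) / e * y ^+ i = y ^+ m.
  have ym : y ^+ m = y ^+ m * g.[y^-1] by rewrite gy mulr1.
  apply: (mulIf e0); rewrite [RHS]mulrBr mulr1 mulr_suml [X in _ = X - _]ym.
  rewrite (@horner_coef_wide _ m.+1) -?def_m // def_m big_ord_recl.
  rewrite /= expr0 mulr1 mulrDr addrC addKr mulr_sumr.
  rewrite [LHS](reindex_inj rev_ord_inj) /=; apply: eq_bigr => i _.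
  rewrite mulrAC divfK // subKn // mulrCA; congr (_ * _).
  by rewrite exprVn -expfB_cond ?(negbTE y0) ?lift0 ?ltn_ord.
(* This is [f] with its leading term rewritten by [sum_g], hence of smaller size. *)
pose h := \poly_(i < m) (f`_i + f`_m * (g`_(m - i) / e)).
apply: (IH h g y) => //.
- have := size_poly m (fun i => f`_i + f`_m * (g`_(m - i) / e)); rewrite -/h.
  by move: le_n; rewrite def_m; lia.
- move=> i; rewrite coef_poly; case: ifP => _; last first.
    by exists 0; [apply: subring0|rewrite mulr0].
  apply: zUD => //; rewrite mulrC; apply: zUM => //.
  by apply: subringM => //; apply: zU_U.
- rewrite horner_poly -fy (@horner_coef_wide _ m.+1) ?def_m //.
  rewrite big_ord_recr /= -sum_g mulr_sumr -big_split /=.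
  by apply: eq_bigr => i _; rewrite mulrDl !mulrA.
Qed.

(** If [y] and [y^-1] were both missing, maximality would express [z^-1] as a polynomial in each of
    them; multiplied by [z], these are two incompatible relations. *)
Lemma maximal_valring : valring U.
Proof.
split => // y; apply: contrapT => /not_orP[Ny NyV].
have y0 : y != 0 by apply/eqP => y0; apply: Ny; rewrite y0; apply: subring0.
have [f Uf fy] := maxU Ny; have [g Ug gy] := maxU NyV.
apply: (@maximal_no_two_relations _ (z *: f) (z *: g) y y0 (leqnn _)).
- by move=> i; rewrite coefZ; exists f`_i.
- by move=> i; rewrite coefZ; exists g`_i.
- by rewrite hornerZ fy mulfV.
- by rewrite hornerZ gy mulfV.
Qed.

End Chevalley.

(** Zorn's lemma, started from [R[x^-1]], gives a subring maximal among those containing [x^-1] but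
    not [x]; the preceding results apply with [z = x^-1]. *)
Lemma exists_valring_avoiding (L : fieldType) (R : set L) (x : L) :
  is_subring R -> ~ adjoin R x^-1 x ->
  exists U, [/\ valring U, R `<=` U, U x^-1 & ~ U x].
Proof.
move=> hR xN.
pose good S := [/\ is_subring S, R `<=` S, S x^-1 & ~ S x].
have [|U [PU maxU]] := @Zorn_bigcup L [set S | S = set0 \/ good S].
  move=> F FP Ftot; rewrite /=.
  have [[S [FS S0]]|noS] := pselect (exists S, F S /\ S <> set0); last first.
    left; apply/seteqP; split => // y [S FS Sy]; apply: noS.
    by exists S; split => // S0; rewrite S0 in Sy.
  right; have {}FP T y : F T -> T y -> good T.
    by move=> FT Ty; case: (FP T FT) => // T0; rewrite T0 in Ty.
  have [y Sy] : S !=set0 by apply/set0P/eqP.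
  have [hS RS Sx NSx] := FP S y FS Sy.
  have common a b : (\bigcup_(X in F) X) a -> (\bigcup_(X in F) X) b ->
      exists T, [/\ F T, is_subring T, T a & T b].
    move=> [T FT Ta] [T' FT' Tb].
    have [hT _ _ _] := FP T a FT Ta; have [hT' _ _ _] := FP T' b FT' Tb.
    case: (Ftot T T' FT FT') => sTT'; first by exists T'; split=> //; apply: sTT'.
    by exists T; split=> //; apply: sTT'.
  split.
  - apply: is_subringP => [|a b Fa Fb|a b Fa Fb]; first by exists S => //; apply: subring1.
      have [T [FT hT Ta Tb]] := common a b Fa Fb.
      by exists T => //; apply: subringB.
    have [T [FT hT Ta Tb]] := common a b Fa Fb.
    by exists T => //; apply: subringM.
  - by move=> a Ra; exists S => //; apply: RS.
  - by exists S.
  - by case=> T FT Tx; have [_ _ _] := FP T x FT Tx.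
have gR : good (adjoin R x^-1).
  by split => //; [apply: adjoin_subring|apply: sub_adjoin|apply: mem_adjoin].
have [hU RU Ux UNx] : good U.
  case: PU => // U0; case: (maxU (adjoin R x^-1)); last by right.
  rewrite U0; split => // /(_ 1); apply.
  by case: gR => h _ _ _; apply: subring1.
exists U; split=> //; apply: (maximal_valring hU Ux); first by rewrite invrK.
move=> y NUy; rewrite invrK; apply: contrapT => Nx.
apply: (maxU (adjoin U y)); last right.
  split; first exact: sub_adjoin.
  by move=> sub; apply: NUy; apply: sub; apply: mem_adjoin.
split => //; first exact: adjoin_subring.
  by move=> a Ra; apply: sub_adjoin => //; apply: RU.
exact: sub_adjoin.
Qed.

(** * Prime ideals and valuation rings *)

Section PrimeIdeals.
Variables (L : fieldType) (R P : set L).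
Hypotheses (hR : is_subring R) (hP : prime_ideal R P).

Lemma primeS : P `<=` R.
Proof. by case: hP => -[]. Qed.

Lemma primeD x y : P x -> P y -> P (x + y).
Proof. by case: hP => -[[_ PD _] _] _ _; apply: PD. Qed.

Lemma prime0 : P 0.
Proof. by case: hP => -[[]]. Qed.

Lemma primeMl r x : R r -> P x -> P (r * x).
Proof. by case: hP => -[[_ _ PM] _] _ _; apply: PM. Qed.

Lemma primeMr r x : P x -> R r -> P (x * r).
Proof. by move=> Px Rr; rewrite mulrC; apply: primeMl. Qed.

Lemma prime_mul x y : R x -> R y -> P (x * y) -> P x \/ P y.
Proof. by case: hP => _ _; apply. Qed.

Lemma prime_proper1 : ~ P 1.
Proof.
move=> P1; case: hP => _ /eqP PR _; apply: PR; apply/seteqP.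
by split => x; [apply: primeS|move=> Rx; rewrite -[x]mulr1; apply: primeMl].
Qed.

Lemma prime_expr x n : R x -> P (x ^+ n) -> P x.
Proof.
move=> Rx; elim: n => [|n IH]; first by rewrite expr0 => /prime_proper1.
by rewrite exprS => /prime_mul[] //; apply: subringX.
Qed.

End PrimeIdeals.

Lemma prime_idealP (L : fieldType) (R P : set L) :
  is_subring R -> ideal R P -> ~ P 1 ->
  (forall x y, R x -> R y -> P (x * y) -> P x \/ P y) -> prime_ideal R P.
Proof.
move=> hR iP P1 PM; split => //; apply/eqP => PR; apply: P1; rewrite PR.
exact: subring1.
Qed.

(** The maximal ideal when [V] is a valuation ring. Zero is added by hand because [0^-1 = 0] lies in
    [V]; that the other elements lie in [V] follows from the valuation property. *)
Definition nonunits (L : fieldType) (V : set L) : set L :=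
  [set x | x = 0 \/ ~ V x^-1].

Section ValuationRings.
Variables (L : fieldType) (V : set L).
Hypothesis hV : valring V.

Let rV : is_subring V := proj1 hV.

Lemma valring_div x y : V (x / y) \/ V (y / x).
Proof. by case: (proj2 hV (x / y)); [left|right; rewrite -invf_div]. Qed.

Lemma nonunitsS : nonunits V `<=` V.
Proof.
by move=> x [->|NVx]; [apply: subring0|case: (proj2 hV x)].
Qed.

Lemma nonunitsM r x : V r -> nonunits V x -> nonunits V (r * x).
Proof.
move=> Vr [->|NVx]; first by left; rewrite mulr0.
have [->|r0] := eqVneq r 0; first by left; rewrite mul0r.
right => Vrx; apply: NVx; have -> : x^-1 = r * (r * x)^-1 by rewrite invfM mulVKf.
exact: subringM.
Qed.

Lemma nonunitsD x y : nonunits V x -> nonunits V y -> nonunits V (x + y).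
Proof.
wlog Vyx : x y / V (y / x).
  move=> wl Mx My; case: (valring_div y x) => ?; first exact: wl.
  by rewrite addrC; apply: wl.
have [->|x0] := eqVneq x 0; first by rewrite add0r.
move=> Mx _; have -> : x + y = (1 + y / x) * x by rewrite mulrDl divfK // mul1r.
by apply: nonunitsM => //; apply: subringD => //; apply: subring1.
Qed.

Lemma nonunits_ideal : ideal V (nonunits V).
Proof.
split; last exact: nonunitsS.
by split; [left|apply: nonunitsD|move=> r x; apply: nonunitsM].
Qed.

Lemma nonunits1 : ~ nonunits V 1.
Proof.
by case=> [/eqP|]; [rewrite oner_eq0|rewrite invr1; apply; apply: subring1].
Qed.

Lemma nonunits_prime : prime_ideal V (nonunits V).
Proof.
apply: prime_idealP; [exact: rV|exact: nonunits_ideal|exact: nonunits1|].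
move=> x y Vx Vy Mxy; case: (pselect (nonunits V x)) => [|NMx]; first by left.
right; move: NMx => /not_orP[/eqP x0 /contrapT Vx1].
by rewrite -[y](mulKf x0); apply: nonunitsM.
Qed.

Lemma prime_sub_nonunits P : prime_ideal V P -> P `<=` nonunits V.
Proof.
move=> hP x Px; have [x0|x0] := eqVneq x 0; [by left|right => Vx].
by apply: (prime_proper1 hP); rewrite -(mulVf x0); apply: (primeMl hP).
Qed.

(** If [s / x] were in [V], then [s] would be a multiple of [x] and lie in [P]. So [x / s] is in
    [V], and primality applies to its product with [s]. *)
Lemma prime_div P x s : prime_ideal V P -> P x -> V s -> ~ P s -> P (x / s).
Proof.
move=> hP Px Vs NPs.
have s0 : s != 0 by apply/eqP => s0; apply: NPs; rewrite s0; apply: prime0 hP.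
have [x0|x0] := eqVneq x 0; first by rewrite x0 mul0r; apply: prime0 hP.
case: (valring_div x s) => Vxs; last first.
  by case: NPs; rewrite -[s](divfK x0); apply: (primeMl hP).
by case: (prime_mul hP Vxs Vs) => //; rewrite divfK.
Qed.

(** The element found is a term of least value. *)
Lemma exists_dominant (T : eqType) (F : T -> L) (s : seq T) :
  has (fun t => F t != 0) s ->
  exists2 t, t \in s /\ F t != 0 & forall t', t' \in s -> V (F t' / F t).
Proof.
elim: s => [//|t s IH] /=.
have [Ft0 /= /IH [t1 [t1s F1] dom1]|Ft _] := eqVneq (F t) 0.
  exists t1; first by rewrite inE t1s orbT.
  move=> t'; rewrite inE => /predU1P[->|]; last exact: dom1.
  by rewrite Ft0 mul0r; apply: subring0.
case: (boolP (has (fun t => F t != 0) s)) => [/IH [t1 [t1s F1] dom1]|/hasPn all0]; last first.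
  exists t; first by rewrite inE eqxx.
  move=> t'; rewrite inE => /predU1P[->|/all0].
    by rewrite divff //; apply: subring1.
  by rewrite negbK => /eqP ->; rewrite mul0r; apply: subring0.
case: (valring_div (F t) (F t1)) => Vt.
  exists t1; first by rewrite inE t1s orbT.
  by move=> t'; rewrite inE => /predU1P[->|] //; apply: dom1.
exists t; first by rewrite inE eqxx.
move=> t'; rewrite inE => /predU1P[->|/dom1 Vt'].
  by rewrite divff //; apply: subring1.
have -> : F t' / F t = (F t' / F t1) * (F t1 / F t) by rewrite mulrA divfK.
exact: subringM.
Qed.

(** Divided by the term of least value, all other terms become nonunits, so a vanishing sum would
    make 1 a nonunit. *)
Lemma sum_neq0_of_distinct_values (T : finType) (F : T -> L) (t0 : T) :
  F t0 != 0 ->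
  (forall s t, s != t -> F s != 0 -> F t != 0 ->
     V (F s / F t) -> V (F t / F s) -> False) ->
  \sum_t F t != 0.
Proof.
move=> F0 dist.
have [|t [_ Ft] dom] := @exists_dominant _ F (enum T).
  by apply/hasP; exists t0 => //; rewrite mem_enum.
apply/eqP; rewrite (bigD1 t) //= => sum0.
apply: nonunits1.
have -> : 1 = - \sum_(s | s != t) F s / F t.
  apply: (mulIf Ft); rewrite mul1r mulNr mulr_suml.
  under eq_bigr => s _ do rewrite divfK //.
  by move/eqP: sum0; rewrite addr_eq0 => /eqP.
rewrite -mulN1r; apply: nonunitsM; first by apply: subringN => //; apply: subring1.
elim/big_ind: _ => [|x y|s st]; [by left|exact: nonunitsD|].
have [Fs|Fs] := eqVneq (F s) 0; first by left; rewrite Fs mul0r.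
right; rewrite invf_div => Vts; apply: (dist s t) => //.
by apply: dom; rewrite mem_enum.
Qed.

End ValuationRings.

Lemma chain_sub (L : fieldType) (P : nat -> set L) n i j :
  (forall i, (i < n)%N -> P i `<` P i.+1) -> (i <= j <= n)%N -> P i `<=` P j.
Proof.
move=> sP /andP[]; elim: j => [|j IH]; first by rewrite leqn0 => /eqP -> _ x.
rewrite leq_eqVlt => /predU1P[-> _ x //|ij jn x Px].
have [sub _] := sP j jn; apply: sub; apply: IH => //.
exact: ltnW.
Qed.

(** The primes of [W] lie in its maximal ideal, hence in [U], and stay prime there. The maximal
    ideal of [U] is strictly above them: it contains [x^-1], a unit of [W]. *)
Lemma prime_chain_subring (L : fieldType) (U W : set L) (x : L) n :
  valring U -> nonunits W `<=` U -> U `<=` W -> W x -> ~ U x ->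
  prime_chain W n -> prime_chain U n.+1.
Proof.
move=> hU MU UW Wx Ux [P [hP sP]].
have PU i : (i <= n)%N -> prime_ideal U (P i).
  move=> /hP hPi; have PMi := prime_sub_nonunits hPi.
  apply: prime_idealP; [by case: hU| |exact: prime_proper1 hPi|].
    split; last by move=> y /PMi; apply: MU.
    split; [exact: prime0 hPi|exact: primeD hPi|].
    by move=> r y Ur Py; apply: (primeMl hPi) => //; apply: UW.
  by move=> y z Uy Uz; apply: (prime_mul hPi); apply: UW.
exists (fun i => if (i <= n)%N then P i else nonunits U); split => i.
  by move=> _; case: leqP => [/PU //|_]; apply: nonunits_prime.
rewrite ltnS => le_in; rewrite le_in; case: ltnP => [/sP //|le_ni].
split; first exact/prime_sub_nonunits/PU.
move=> /(_ x^-1) sub; have : nonunits W x^-1.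
  apply: (prime_sub_nonunits (hP i le_in)); apply: sub.
  by right; rewrite invrK.
case=> [/eqP|]; last by rewrite invrK; apply.
rewrite invr_eq0 => /eqP x0; apply: Ux; rewrite x0.
by apply: subring0; case: hU.
Qed.

(** * Restriction of a valuation ring from K(X) to K *)

Section RationalFunctions.
Variables (K L : fieldType) (iota : {rmorphism K -> L}) (X : L).

(** Together with [X_transcendental] and [X_generates] below, this presents [L] as the rational
    function field K(X) without fixing its construction. *)
Definition eval_at (f : {poly K}) : L := (map_poly iota f).[X].

Lemma eval_atD f g : eval_at (f + g) = eval_at f + eval_at g.
Proof. by rewrite /eval_at rmorphD hornerD. Qed.

Lemma eval_atM f g : eval_at (f * g) = eval_at f * eval_at g.
Proof. by rewrite /eval_at rmorphM hornerM. Qed.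

Lemma eval_atN f : eval_at (- f) = - eval_at f.
Proof. by rewrite /eval_at rmorphN hornerN. Qed.

Lemma eval_atC c : eval_at c%:P = iota c.
Proof. by rewrite /eval_at map_polyC hornerC. Qed.

Lemma eval_atZ c f : eval_at (c *: f) = iota c * eval_at f.
Proof. by rewrite -mul_polyC eval_atM eval_atC. Qed.

Lemma eval_atXn f n : eval_at (f ^+ n) = eval_at f ^+ n.
Proof. by rewrite /eval_at rmorphXn horner_exp. Qed.

Lemma eval_at0 : eval_at 0 = 0.
Proof. by rewrite -polyC0 eval_atC rmorph0. Qed.

Lemma eval_at_sum (I : finType) (F : I -> {poly K}) :
  eval_at (\sum_i F i) = \sum_i eval_at (F i).
Proof. by rewrite /eval_at rmorph_sum horner_sum. Qed.

Hypothesis X_transcendental : forall f, eval_at f = 0 -> f = 0.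
Hypothesis X_generates : forall x : L, exists f g,
  g != 0 /\ x = eval_at f / eval_at g.

Lemma eval_at_neq0 f : f != 0 -> eval_at f != 0.
Proof. by apply: contra_neq; apply: X_transcendental. Qed.

Lemma eval_at_inj : injective eval_at.
Proof.
move=> f g fg; apply/subr0_eq/X_transcendental.
by rewrite eval_atD eval_atN fg subrr.
Qed.

(* The monomials [a^i b^j] with [i, j < 2d + 2] have a common denominator [h^(4d+4)]
   and numerators of degree at most [d (4d + 4) < (2d + 2)^2 - 1]. *)
Lemma algebraically_dependent (a b : L) :
  exists N (c : 'I_N * 'I_N -> K), (exists t, c t != 0) /\
    \sum_t iota (c t) * a ^+ t.1 * b ^+ t.2 = 0.
Proof.
have [f1 [g1 [g10 ->]]] := X_generates a; have [f2 [g2 [g20 ->]]] := X_generates b.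
pose h : {poly K} := g1 * g2; pose f : {poly K} := f1 * g2; pose g : {poly K} := f2 * g1.
have h0 : h != 0 by rewrite mulf_neq0.
have eh0 := eval_at_neq0 h0.
have -> : eval_at f1 / eval_at g1 = eval_at f / eval_at h.
  by rewrite -[LHS]mulr1 -(divff (eval_at_neq0 g20)) mulf_div -!eval_atM.
have -> : eval_at f2 / eval_at g2 = eval_at g / eval_at h.
  rewrite -[LHS]mulr1 -(divff (eval_at_neq0 g10)) mulf_div -!eval_atM.
  by rewrite [g2 * g1]mulrC.
clearbody h f g; pose d := maxn (size f) (maxn (size g) (size h)).
have [df dg dh] : [/\ size f <= d.+1, size g <= d.+1 & size h <= d.+1]%N.
  by rewrite /d; split; lia.
pose N := (d.*2.+2)%N; pose T : finType := ('I_N * 'I_N)%type.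
pose p (t : T) : {poly K} := (f ^+ t.1 * h ^+ (N - t.1)) * (g ^+ t.2 * h ^+ (N - t.2)).
have size_exp (q : {poly K}) n : (size q <= d.+1 -> size (q ^+ n) <= (d * n).+1)%N.
  move=> dq; apply: leq_trans (size_poly_exp_leq _ _) _; rewrite ltnS.
  by rewrite leq_mul2r; apply/orP; right; lia.
have size_mul (q r : {poly K}) k l : (size q <= k.+1 -> size r <= l.+1 ->
    size (q * r)%R <= (k + l).+1)%N.
  by move=> qk rl; apply: leq_trans (size_polyMleq _ _) _; lia.
have size_p t : (size (p t) <= (d * N + d * N).+1)%N.
  have half (q : {poly K}) (i : 'I_N) : (size q <= d.+1)%N ->
      (size (q ^+ i * h ^+ (N - i))%R <= (d * N).+1)%N.
    move=> dq; have -> : (d * N = d * i + d * (N - i))%N.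
      by rewrite -mulnDr subnKC // ltnW.
    by apply: size_mul; apply: size_exp.
  by apply: size_mul; apply: half.
pose M : 'M[K]_(#|T|, (d * N + d * N).+1) := \matrix_(r, k) (p (enum_val r))`_k.
(* There are [(2d+2)^2] rows, one for each monomial, and only [2dN + 1 = (2d+1)^2] columns; a vector
   of the left kernel is a linear relation between the numerators. *)
have : kermx M != 0.
  rewrite kermx_eq0 -row_leq_rank -ltnNge.
  apply: leq_ltn_trans (rank_leq_col M) _.
  by rewrite card_prod card_ord /N; lia.
case/rowV0Pn=> v /sub_kermxP vM /rV0Pn[r vr].
exists N, (fun t => v 0 (enum_rank t)); split.
  by exists (enum_val r); rewrite enum_valK.
have sum0 : \sum_t v 0 (enum_rank t) *: p t = 0.
  apply/polyP => k; rewrite coef0 coef_sum.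
  case: (ltnP k (d * N + d * N).+1) => [lt_k|ge_k]; last first.
    by apply: big1 => t _; rewrite coefZ nth_default ?mulr0 // (leq_trans (size_p t)).
  have := congr1 (fun A : 'rV_ _ => A 0 (Ordinal lt_k)) vM; rewrite !mxE => Mk.
  rewrite -[RHS]Mk.
  rewrite (reindex (@enum_val T predT)) /=; last exact/onW_bij/enum_val_bij.
  by apply: eq_bigr => i _; rewrite coefZ enum_valK mxE.
apply: (mulfI (expf_neq0 (N + N)%N eh0)); rewrite mulr0 -[RHS]eval_at0 -sum0.
rewrite eval_at_sum mulr_sumr; apply: eq_bigr => -[i j] _ /=.
have half q (k : 'I_N) : eval_at h ^+ N * (q / eval_at h) ^+ k =
    q ^+ k * eval_at h ^+ (N - k).
  have kN : (k <= N)%N := ltnW (ltn_ord k).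
  by rewrite exprMn mulrCA exprVn -expfB_cond // (negbTE eh0).
rewrite eval_atZ !eval_atM !eval_atXn -(half (eval_at f) i) -(half (eval_at g) j) exprD.
move: (eval_at h ^+ N) ((_ / _) ^+ i) ((_ / _) ^+ j) (iota _) => H A B e; ring.
Qed.

Section Restriction.
Variables (W : set L) (hW : valring W).
Let rW : is_subring W := proj1 hW.

Lemma restriction_valring : valring (iota @^-1` W).
Proof.
split => [|x]; last by rewrite /= fmorphV; apply: (proj2 hW).
apply: is_subringP => [|x y Wx Wy|x y Wx Wy] /=; first by rewrite rmorph1; apply: subring1.
  by rewrite rmorphB; apply: subringB.
by rewrite rmorphM; apply: subringM.
Qed.

Lemma restriction_prime P : prime_ideal W P -> prime_ideal (iota @^-1` W) (iota @^-1` P).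
Proof.
move=> hP; apply: prime_idealP => //=.
- by case: restriction_valring.
- split; last by move=> x; apply: (primeS hP).
  split => [|x y Px Py|r x Wr Px] /=; first by rewrite rmorph0; apply: prime0 hP.
    by rewrite rmorphD; apply: (primeD hP).
  by rewrite rmorphM; apply: (primeMl hP).
- by rewrite rmorph1; apply: prime_proper1 hP.
- by move=> x y Wx Wy; rewrite rmorphM; apply: (prime_mul hP).
Qed.

(* [a] and [b] have values independent over those of [K], hence would be
   algebraically independent over [K]. *)
Lemma no_two_gaps P P' Q Q' a b :
  prime_ideal W P -> prime_ideal W P' -> prime_ideal W Q -> prime_ideal W Q' ->
  P `<=` P' -> P' `<=` Q -> P' a -> ~ P a -> Q' b -> ~ Q b ->
  (forall c, P' (iota c) -> P (iota c)) -> (forall c, Q' (iota c) -> Q (iota c)) ->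
  False.
Proof.
move=> hP hP' hQ hQ' PP' P'Q P'a Pa Q'b Qb gapP gapQ.
have Wa := primeS hP' P'a; have Wb := primeS hQ' Q'b.
have a0 : a != 0 by apply/eqP => a0; apply: Pa; rewrite a0; apply: prime0 hP.
have b0 : b != 0 by apply/eqP => b0; apply: Qb; rewrite b0; apply: prime0 hQ.
have P'b : ~ P' b by move/P'Q.
have Pb : ~ P b by move/PP'.
have nexp R x n : prime_ideal W R -> W x -> ~ R x -> ~ R (x ^+ n).
  by move=> hR Wx NRx /(prime_expr rW hR Wx).
(* Up to a unit and powers of [b], a positive power of [a] never has the value of a constant: the
   constant would lie in [P'], hence in [P], although [P] contains neither [a] nor [b]. *)
have powP c k m m' w : (0 < k)%N -> W w -> W w^-1 -> w != 0 ->
    iota c * b ^+ m = w * (a ^+ k * b ^+ m') -> False.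
  move=> k0 Ww Ww1 w0 eq_c; pose y := w * (a ^+ k * b ^+ m').
  have P'y : P' y.
    apply: (primeMl hP') => //; apply: (primeMr hP'); last exact: subringX.
    by rewrite -(prednK k0) exprS; apply: (primeMr hP') => //; apply: subringX.
  have def_c : iota c = y / b ^+ m by rewrite /y -eq_c mulfK // expf_neq0.
  have P'c : P' (iota c).
    rewrite def_c; apply: (prime_div hW hP') => //; first exact: subringX.
    exact: nexp.
  have Pc := gapP c P'c.
  have : P (w^-1 * (iota c * b ^+ m)).
    by apply: (primeMl hP) => //; apply: (primeMr hP) => //; apply: subringX.
  rewrite eq_c mulKf // => /(prime_mul hP) -[]; [exact: subringX..| |].
    exact: nexp.
  exact: nexp.
have powQ c k w : (0 < k)%N -> W w -> W w^-1 -> w != 0 ->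
    iota c = w * b ^+ k -> False.
  move=> k0 Ww Ww1 w0 eq_c.
  have Q'c : Q' (iota c).
    rewrite eq_c; apply: (primeMl hQ') => //.
    by rewrite -(prednK k0) exprS; apply: (primeMr hQ') => //; apply: subringX.
  have : Q (w^-1 * iota c) by apply: (primeMl hQ) => //; apply: gapQ.
  rewrite eq_c mulKf //; exact: nexp.
have [N [c [[t0 c0] sum0]]] := algebraically_dependent a b.
pose F (t : 'I_N * 'I_N) := iota (c t) * a ^+ t.1 * b ^+ t.2.
have an n : a ^+ n != 0 by rewrite expf_neq0.
have bn n : b ^+ n != 0 by rewrite expf_neq0.
move/eqP: sum0; apply/negP; apply: (sum_neq0_of_distinct_values hW (F := F) (t0 := t0)).
  by rewrite /F !mulf_neq0 // fmorph_eq0.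
(* Two terms of equal value differ by a unit [w]. Unequal exponents of [a] contradict [powP]; with
   equal exponents of [a], unequal exponents of [b] contradict [powQ]. *)
have distinct s t : F s != 0 -> F t != 0 -> W (F s / F t) -> W (F t / F s) ->
    (s.1 < t.1)%N \/ (s.1 = t.1 :> nat /\ (s.2 < t.2)%N) -> False.
  move=> Fs Ft Wst Wts lt_st; pose w := F s / F t.
  have w1 : w^-1 = F t / F s by rewrite invf_div.
  have w0 : w != 0 by rewrite mulf_neq0 ?invr_eq0.
  have ct : iota (c t) != 0 by apply: contraNneq Ft => ct; rewrite /F ct !mul0r.
  have Ww : W w := Wst.
  have Fst : F s = w * F t by rewrite divfK.
  clearbody w.
  have {}Fst : iota (c s / c t) * a ^+ s.1 * b ^+ s.2 = w * (a ^+ t.1 * b ^+ t.2).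
    have -> : iota (c s / c t) * a ^+ s.1 * b ^+ s.2 = F s / iota (c t).
      by rewrite fmorph_div [_ / _ * _]mulrAC [_ / _ * _]mulrAC.
    by rewrite Fst /F -mulrA; congr (_ * _); rewrite mulrC -!mulrA mulKf.
  case: lt_st => [lt_st|[eq_st lt_st]].
    apply: (powP (c s / c t) (t.1 - s.1)%N s.2 t.2 w) => //.
    - by rewrite subn_gt0.
    - by rewrite w1.
    apply: (mulfI (an s.1)); rewrite mulrCA mulrA Fst.
    rewrite [RHS]mulrCA; congr (_ * _); rewrite [RHS]mulrA -exprD subnKC //.
    exact: ltnW.
  apply: (powQ (c s / c t) (t.2 - s.2)%N w) => //.
  - by rewrite subn_gt0.
  - by rewrite w1.
  apply: (mulIf (bn s.2)); apply: (mulIf (an s.1)).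
  rewrite mulrAC Fst eq_st -!mulrA; congr (_ * _).
  by rewrite [RHS]mulrA -exprD subnK ?(ltnW lt_st) // mulrC.
move=> s t st Fs Ft Wst Wts; move/eqP: st => st; apply: st.
case: (ltngtP s.1 t.1) => [lt|lt|eq1].
- by case: (distinct s t) => //; left.
- by case: (distinct t s) => //; left.
case: (ltngtP s.2 t.2) => [lt|lt|eq2].
- by case: (distinct s t) => //; right.
- by case: (distinct t s) => //; right.
case: s t eq1 eq2 {Fs Ft Wst Wts} => [s1 s2] [t1 t2] /= /val_inj -> /val_inj ->.
by [].
Qed.

(** By [no_two_gaps] at most one of the [n + 1] inclusions becomes an equality in [K]; dropping the
    upper term of that inclusion leaves a strict chain. *)
Lemma restriction_prime_chain n :
  prime_chain W n.+1 -> prime_chain (iota @^-1` W) n.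
Proof.
move=> [P [hP sP]].
pose p i := iota @^-1` P i; pose gap i := p i.+1 `<=` p i.
have pS i : (i <= n)%N -> p i `<=` p i.+1.
  by move=> le_in x; have [+ _] := sP i le_in; apply.
have gap_unique i j : (i < j)%N -> (j <= n)%N -> gap i -> gap j -> False.
  move=> lt_ij le_jn gi gj; have le_in : (i <= n)%N by lia.
  have [Pi /existsNP[a /not_implyP[Pa NPa]]] := sP i le_in.
  have [Pj /existsNP[b /not_implyP[Pb NPb]]] := sP j le_jn.
  apply: (@no_two_gaps (P i) (P i.+1) (P j) (P j.+1) a b) => //; try by apply: hP; lia.
  by apply: (chain_sub sP); lia.
(* If nothing collapses, any term may be dropped, and [i0 = 0] is taken. *)
have [i0 gap_i0] : exists i0, forall i, (i <= n)%N -> gap i -> i = i0.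
  have [[i0 [le_i0n gap0]]|nogap] := pselect (exists i, (i <= n)%N /\ gap i); last first.
    by exists 0%N => i le_in gi; case: nogap; exists i.
  exists i0 => i le_in gi; case: (ltngtP i i0) => // lt_i.
    by case: (gap_unique i i0).
  by case: (gap_unique i0 i).
exists (fun j => if (j <= i0)%N then p j else p j.+1); split => j le_jn.
  by case: ifP => _; apply: restriction_prime; apply: hP; lia.
case: (ltngtP j i0) => [lt_j|lt_j|eq_j].
- split; first by apply: pS; lia.
  by move=> /gap_i0 => /(_ (ltnW le_jn)); lia.
- split; first by apply: pS; lia.
  by move=> /gap_i0 => /(_ le_jn); lia.
(* This inclusion jumps over the dropped term; if it were an equality, both inclusions composing it
   would collapse. *)
split; first by move=> x pjx; apply: (pS j.+1 le_jn); apply: (pS j (ltnW le_jn)).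
move=> sub; have gj : gap j by move=> x pjx; apply: sub; apply: (pS j.+1).
have gj1 : gap j.+1 by move=> x /sub; apply: (pS j (ltnW le_jn)).
exact: (gap_unique j j.+1).
Qed.

End Restriction.

End RationalFunctions.

(** * The Gauss extension *)

Section GaussExtension.
Variables (K L : fieldType) (iota : {rmorphism K -> L}) (X : L).
Local Notation eval_at := (eval_at iota X).
Hypothesis X_transcendental : forall f, eval_at f = 0 -> f = 0.
Hypothesis X_generates : forall x : L, exists f g,
  g != 0 /\ x = eval_at f / eval_at g.
Variables (V : set K) (hV : valring V).

Let rV : is_subring V := proj1 hV.

(** As [V] is local, a unit coefficient means that the content is all of [V]. *)
Definition primitive (g : {poly K}) : Prop :=
  coefs_in V g /\ exists i, ~ nonunits V g`_i.

Lemma primitive_neq0 g : primitive g -> g != 0.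
Proof. by case=> _ [i]; apply: contra_not_neq => ->; rewrite coef0; left. Qed.

Lemma primitive1 : primitive 1.
Proof.
split; first by apply: coefs_inC => //; apply: subring1.
by exists 0%N; rewrite coef1; apply: nonunits1.
Qed.

Lemma primitive_first_unit g : primitive g ->
  exists i, ~ nonunits V g`_i /\ forall j, (j < i)%N -> nonunits V g`_j.
Proof.
case=> _ [i0 Ni0]; have ex : exists i, `[< ~ nonunits V g`_i >].
  by exists i0; apply/asboolP.
case: (ex_minnP ex) => i /asboolP Ni min_i; exists i; split => // j ltji.
by apply: contrapT => /asboolP /min_i; rewrite leqNgt ltji.
Qed.

(* In the product, the coefficient whose index is the sum of those of the first
   unit coefficients of the factors is a unit. *)
Lemma primitiveM f g : primitive f -> primitive g -> primitive (f * g).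
Proof.
move=> pf pg; have [Vf Vg] := (proj1 pf, proj1 pg).
split; first exact: coefs_inM.
have [i [Ni fi]] := primitive_first_unit pf; have [j [Nj gj]] := primitive_first_unit pg.
have hM := nonunits_prime hV.
have iij : (i < (i + j).+1)%N by lia.
exists (i + j)%N; rewrite coefM (bigD1 (Ordinal iij)) //= addKn.
set S := \sum_(_ | _) _ => MiS.
have MS : nonunits V S.
  rewrite /S; elim/big_ind: _ => [|x y|k ki]; [by left|exact: nonunitsD|].
  case: (ltngtP k i) => [ltki|ltik|eqki].
  - by apply: (primeMr hM) => //; apply: fi.
  - by apply: nonunitsM => //; apply: gj; have := ltn_ord k; lia.
  - by case/eqP: ki; apply: val_inj.
have : nonunits V (f`_i * g`_j).
  rewrite -[X in nonunits V X](addrK S); apply: nonunitsD => //.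
  rewrite -mulN1r; apply: nonunitsM => //; apply: subringN => //; exact: subring1.
by case/(prime_mul hM).
Qed.

(** The factor [c] is a coefficient of least value. *)
Lemma primitive_part f : f != 0 -> exists c g, [/\ c != 0, f = c *: g & primitive g].
Proof.
move=> f0; have [|i [_ fi] dom] := @exists_dominant _ _ hV _ (fun i => f`_i) (seq.iota 0 (size f)).
  apply/hasP; exists (size f).-1; last by rewrite -lead_coefE lead_coef_eq0.
  by rewrite mem_iota /= add0n ltn_predL size_poly_gt0.
exists f`_i, ((f`_i)^-1 *: f); split => //; first by rewrite scalerA divff // scale1r.
split => [j|]; last first.
  by exists i; rewrite coefZ mulVf //; apply: nonunits1.
rewrite coefZ mulrC; case: (ltnP j (size f)) => [lt_j|ge_j].
  by apply: dom; rewrite mem_iota.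
by rewrite [f`_j]nth_default // mul0r; apply: subring0.
Qed.

(** The ring V(X): the localization of V[X] at the primitive polynomials, whose valuation sends a
    polynomial to the least value of its coefficients. *)
Definition gauss_ext : set L :=
  [set x | exists f g, [/\ coefs_in V f, primitive g & x = eval_at f / eval_at g]].

Let ev0 g : primitive g -> eval_at g != 0.
Proof. by move=> /primitive_neq0; apply: eval_at_neq0. Qed.

Lemma gauss_ext_subring : is_subring gauss_ext.
Proof.
apply: is_subringP => [|_ _ [f [g [Vf pg ->]]] [f' [g' [Vf' pg' ->]]]|
  _ _ [f [g [Vf pg ->]]] [f' [g' [Vf' pg' ->]]]].
- exists 1, 1; split; [by case: primitive1|exact: primitive1|].
  by rewrite divff // ev0 //; apply: primitive1.
- exists (f * g' - f' * g), (g * g'); split; last 1 first.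
  + rewrite eval_atD eval_atN !eval_atM -mulNr addf_div ?ev0 //.
    by rewrite mulNr.
  + have [[Vg _] [Vg' _]] := (pg, pg').
    by apply: coefs_inB => //; apply: coefs_inM.
  + exact: primitiveM.
- exists (f * f'), (g * g'); split; last 1 first.
  + by rewrite !eval_atM mulf_div.
  + exact: coefs_inM.
  + exact: primitiveM.
Qed.

(** The primitive parts of numerator and denominator form a unit, so the extension has the same
    value group as [V]. *)
Lemma gauss_ext_unit_part x : x != 0 ->
  exists c u, [/\ x = iota c * u, gauss_ext u, gauss_ext u^-1 & u != 0].
Proof.
move=> x0; have [f [g [g0 def_x]]] := X_generates x.
have f0 : f != 0 by apply: contraNneq x0 => f0; rewrite def_x f0 eval_at0 mul0r.
have [c [f1 [c0 def_f pf]]] := primitive_part f0.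
have [d [g1 [d0 def_g pg]]] := primitive_part g0.
exists (c / d), (eval_at f1 / eval_at g1); split.
- by rewrite def_x def_f def_g !eval_atZ fmorph_div mulf_div.
- by exists f1, g1; split => //; case: pf.
- by exists g1, f1; rewrite invf_div; split => //; case: pg.
- by rewrite mulf_neq0 ?invr_eq0 ?ev0.
Qed.

(** If [c = f / g] in K(X), then [c *: g = f] already as polynomials; comparison at a unit
    coefficient of [g] puts [c] in [V]. *)
Lemma gauss_ext_const c : gauss_ext (iota c) <-> V c.
Proof.
split => [[f [g [Vf pg cfg]]]|Vc].
  have cg : c *: g = f.
    apply: (eval_at_inj X_transcendental).
    by rewrite eval_atZ cfg divfK // ev0.
  have [Vg [i /not_orP[/eqP gi0 /contrapT Vgi]]] := pg.
  by rewrite -[c](mulfK gi0) -coefZ cg; apply: subringM.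
exists c%:P, 1; split; [exact: coefs_inC|exact: primitive1|].
by rewrite -polyC1 !eval_atC rmorph1 divr1.
Qed.

Lemma gauss_ext_valring : valring gauss_ext.
Proof.
split; first exact: gauss_ext_subring.
move=> x; have [->|x0] := eqVneq x 0; first by left; apply: subring0 gauss_ext_subring.
have [c [u [-> Wu Wu1 _]]] := gauss_ext_unit_part x0; rewrite invfM -fmorphV.
by case: (proj2 hV c) => /gauss_ext_const Wc; [left|right];
  apply: subringM => //; apply: gauss_ext_subring.
Qed.

(** Single products suffice instead of finite sums: of two elements of [K], one divides the other
    over [V]. *)
Definition extended_ideal (P : set K) : set L :=
  [set x | exists c u, [/\ P c, gauss_ext u & x = iota c * u]].

Lemma extended_ideal_const P c : prime_ideal V P -> extended_ideal P (iota c) -> P c.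
Proof.
move=> hP [d [u [Pd Wu cdu]]]; have [d0|d0] := eqVneq d 0.
  move/eqP: cdu; rewrite d0 rmorph0 mul0r fmorph_eq0 => /eqP ->.
  exact: prime0 hP.
have : gauss_ext (iota (c / d)).
  by rewrite fmorph_div cdu mulrAC mulfV ?mul1r // fmorph_eq0.
by move/gauss_ext_const => Vcd; rewrite -[c](divfK d0); apply: (primeMl hP).
Qed.

(** Up to units of the extension every nonzero element is a constant, so primality reduces to that
    of [P]. *)
Lemma extended_ideal_prime P : prime_ideal V P -> prime_ideal gauss_ext (extended_ideal P).
Proof.
have rW := gauss_ext_subring; move=> hP; apply: prime_idealP => //.
- split; last first.
    move=> _ [c [u [Pc Wu ->]]]; apply: subringM => //.
    by apply/gauss_ext_const; apply: (primeS hP).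
  split; first by exists 0, 1; rewrite rmorph0 mul0r; split; [exact: prime0 hP|exact: subring1|].
    move=> _ _ [c [u [Pc Wu ->]]] [d [w [Pd Ww ->]]].
    wlog Vdc : c d u w Pc Pd Wu Ww / V (d / c).
      move=> wl; case: (valring_div hV d c) => ?; first exact: wl.
      by rewrite addrC; apply: wl.
    have [c0|c0] := eqVneq c 0.
      by exists d, w; split => //; rewrite c0 rmorph0 mul0r add0r.
    exists c, (u + iota (d / c) * w); split => //.
      by apply: subringD => //; apply: subringM => //; apply/gauss_ext_const.
    by rewrite mulrDr mulrA -rmorphM mulrC [c * _]mulrC divfK // mulrC.
  move=> r _ Wr [c [u [Pc Wu ->]]]; exists c, (r * u); split => //.
    exact: subringM.
  by rewrite mulrCA.
- by rewrite -(rmorph1 iota) => /(extended_ideal_const hP); apply: prime_proper1 hP.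
- move=> x y Wx Wy Pxy.
  have [->|x0] := eqVneq x 0.
    by left; exists 0, 1; rewrite rmorph0 mul0r; split; [exact: prime0 hP|exact: subring1|].
  have [->|y0] := eqVneq y 0.
    by right; exists 0, 1; rewrite rmorph0 mul0r; split; [exact: prime0 hP|exact: subring1|].
  have [c [u [def_x Wu Wu1 u0]]] := gauss_ext_unit_part x0.
  have [d [w [def_y Ww Ww1 w0]]] := gauss_ext_unit_part y0.
  have Vc : V c.
    apply/gauss_ext_const; rewrite -[iota c](mulfK u0) -def_x; exact: subringM.
  have Vd : V d.
    apply/gauss_ext_const; rewrite -[iota d](mulfK w0) -def_y; exact: subringM.
  have : P (c * d).
    apply: (extended_ideal_const hP); case: Pxy => e [v [Pe Wv xy_ev]].
    exists e, (v * (u^-1 * w^-1)); split => //.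
      by do 2! apply: subringM => //.
    by rewrite mulrA -xy_ev def_x def_y rmorphM [in RHS]mulrACA !mulfK.
  case/(prime_mul hP Vc Vd) => ?; [left|right].
    by exists c, u.
  by exists d, w.
Qed.

Lemma gauss_ext_prime_chain n : prime_chain V n -> prime_chain gauss_ext n.
Proof.
move=> [P [hP sP]]; exists (fun i => extended_ideal (P i)); split => i lt_in.
  exact/extended_ideal_prime/hP.
have [sub /existsNP[c /not_implyP[Pc NPc]]] := sP i lt_in; split.
  by move=> _ [d [u [Pd Wu ->]]]; exists d, u; split => //; apply: sub.
move=> sub'; apply: NPc; apply: (extended_ideal_const (hP i (ltnW lt_in))); apply: sub'.
by exists c, 1; rewrite mulr1; split => //; apply: subring1 gauss_ext_subring.
Qed.

End GaussExtension.

(** * Numerators and denominators in a fraction field *)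

Lemma fraction_repr (R : idomainType) (x : {fraction R}) :
  x = tofrac (\n_(repr x)) / tofrac (\d_(repr x)).
Proof.
have d0 : tofrac (\d_(repr x)) != 0 by rewrite tofrac_eq0 denom_ratioP.
apply: (canRL (mulfK d0)); rewrite -{1}[x]reprK; unlock tofrac.
rewrite -[LHS]FracField.pi_mul; apply/eqmodP; rewrite /= FracField.equivfE /FracField.mulf.
by rewrite !numden_Ratio ?mulf_neq0 ?oner_neq0 ?denom_ratioP // !mulr1 mulrC.
Qed.

Lemma fractionP (R : idomainType) (x : {fraction R}) :
  exists a b, b != 0 /\ x = tofrac a / tofrac b.
Proof.
by exists (\n_(repr x)), (\d_(repr x)); rewrite -fraction_repr denom_ratioP.
Qed.

(** * Fractions of polynomials *)

Section FractionPolyC.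
Variable D : idomainType.
Local Notation K := {fraction D}.
Local Notation L := {fraction {poly D}}.

(** The canonical embedding of K into K(X), defined on chosen representatives; [frac_polyC_div]
    shows that the choice is immaterial. *)
Definition frac_polyC (x : K) : L :=
  tofrac (\n_(repr x))%:P / tofrac (\d_(repr x))%:P.

Lemma tofrac_polyC_eq0 (b : D) : (tofrac b%:P == 0 :> L) = (b == 0).
Proof. by rewrite tofrac_eq0 polyC_eq0. Qed.

Lemma frac_polyC_div a b : b != 0 ->
  frac_polyC (tofrac a / tofrac b) = tofrac a%:P / tofrac b%:P.
Proof.
move=> b0; pose x : K := tofrac a / tofrac b.
have d0 : \d_(repr x) != 0 by apply: denom_ratioP.
have /eqP : tofrac a / tofrac b = tofrac (\n_(repr x)) / tofrac (\d_(repr x)).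
  exact: fraction_repr.
rewrite eqr_div ?tofrac_eq0 // -!tofracM tofrac_eq => /eqP ad_nb.
apply/eqP; rewrite eqr_div ?tofrac_polyC_eq0 // -!tofracM -!polyCM tofrac_eq.
by rewrite ad_nb.
Qed.

Lemma frac_polyC_tofrac a : frac_polyC (tofrac a) = tofrac a%:P.
Proof.
by rewrite -[X in frac_polyC X]divr1 -tofrac1 frac_polyC_div ?oner_neq0 // tofrac1 divr1.
Qed.

Lemma frac_polyC_zmod_morphism : zmod_morphism frac_polyC.
Proof.
move=> x y; have [a [b [b0 ->]]] := fractionP x; have [c [d [d0 ->]]] := fractionP y.
rewrite !frac_polyC_div // -!mulNr !addf_div ?tofrac_polyC_eq0 ?tofrac_eq0 //.
rewrite -!tofracN -!tofracM -!tofracD frac_polyC_div ?mulf_neq0 //.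
by rewrite polyCD !polyCM polyCN.
Qed.

Lemma frac_polyC_monoid_morphism : monoid_morphism frac_polyC.
Proof.
split=> [|x y]; first by rewrite -tofrac1 frac_polyC_tofrac.
have [a [b [b0 ->]]] := fractionP x; have [c [d [d0 ->]]] := fractionP y.
rewrite !frac_polyC_div // !mulf_div -!tofracM frac_polyC_div ?mulf_neq0 //.
by rewrite !polyCM.
Qed.

HB.instance Definition _ := GRing.isZmodMorphism.Build K L frac_polyC
  frac_polyC_zmod_morphism.
HB.instance Definition _ := GRing.isMonoidMorphism.Build K L frac_polyC
  frac_polyC_monoid_morphism.

Definition frac_X : L := tofrac 'X.

Lemma eval_at_tofrac (f : {poly D}) :
  eval_at frac_polyC frac_X (map_poly (@tofrac D) f) = tofrac f.
Proof.
rewrite /eval_at -map_poly_comp (eq_map_poly (g := (@tofrac _) \o polyC)); last first.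
  by move=> a; rewrite /= frac_polyC_tofrac.
by rewrite map_poly_comp horner_map /= -[X in tofrac X]/(f \Po 'X) comp_polyXr.
Qed.

(** The multiplicative set [P] is a parameter: it will be the set of nonzero elements, and later the
    complement of a prime. *)
Lemma fraction_common_denominator (P : set D) (n : nat) (F : nat -> K) :
  P 1 -> (forall x y, P x -> P y -> P (x * y)) ->
  (forall i, exists a b, P b /\ F i * tofrac b = tofrac a) ->
  exists2 s, P s & forall i, (i < n)%N -> exists a, F i * tofrac s = tofrac a.
Proof.
move=> P1 PM PF; elim: n => [|n [s Ps IH]]; first by exists 1.
have [a [b [Pb Fn]]] := PF n; exists (s * b); first exact: PM.
move=> i; rewrite ltnS leq_eqVlt => /predU1P[->|/IH[c Fi]].
  by exists (a * s); rewrite !tofracM -Fn mulrAC mulrA.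
by exists (c * b); rewrite !tofracM -Fi mulrA.
Qed.

Lemma poly_clear_denominators (f : {poly K}) :
  exists2 s, s != 0 & exists g : {poly D}, tofrac s *: f = map_poly (@tofrac D) g.
Proof.
have [||i|s s0 hs] := @fraction_common_denominator [set s | s != 0] (size f) (fun i => f`_i).
- exact: oner_neq0.
- by move=> x y /= x0 y0; rewrite mulf_neq0.
- have [a [b [b0 ->]]] := fractionP f`_i; exists a, b; split => //.
  by rewrite divfK // tofrac_eq0.
exists s => //.
have /choice[c hc] i : exists a, (i < size f)%N -> f`_i * tofrac s = tofrac a.
  by case: (ltnP i (size f)) => [/hs[a ha]|_]; [exists a|exists 0].
exists (\poly_(i < size f) c i); apply/polyP => i.
rewrite coefZ coef_map coef_poly mulrC; case: (ltnP i (size f)) => [/hc //|ge_i].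
by rewrite nth_default // mul0r raddf0.
Qed.

Lemma frac_X_transcendental (f : {poly K}) : eval_at frac_polyC frac_X f = 0 -> f = 0.
Proof.
move=> f0; have [s s0 [g def_g]] := poly_clear_denominators f.
have g0 : g = 0.
  by apply/eqP; rewrite -tofrac_eq0 -eval_at_tofrac -def_g eval_atZ f0 mulr0.
move/eqP: def_g; rewrite g0 rmorph0 scaler_eq0 tofrac_eq0 (negbTE s0) => /eqP.
exact.
Qed.

Lemma frac_X_generates (x : L) : exists f g : {poly K},
  g != 0 /\ x = eval_at frac_polyC frac_X f / eval_at frac_polyC frac_X g.
Proof.
have [f [g [g0 ->]]] := fractionP x.
exists (map_poly (@tofrac D) f), (map_poly (@tofrac D) g); rewrite !eval_at_tofrac.
split=> //; apply: contraNneq g0 => g0.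
by rewrite -tofrac_eq0 -eval_at_tofrac g0 eval_at0.
Qed.

End FractionPolyC.

(** * Centers of the valuation overrings for the tilde operation *)

Section SemistarCenters.
Variable D : idomainType.
Local Notation K := {fraction D}.
Local Notation dom := (@dom D).

Lemma dom_subring : is_subring dom.
Proof.
apply: is_subringP => [|_ _ [a _ <-] [b _ <-]|_ _ [a _ <-] [b _ <-]].
- by exists 1; rewrite ?tofrac1.
- by exists (a - b); rewrite ?tofracB.
- by exists (a * b); rewrite ?tofracM.
Qed.

Lemma dom_tofrac a : dom (tofrac a).
Proof. by exists a. Qed.

Lemma domP x : dom x -> exists a, x = tofrac a.
Proof. by case=> a _ <-; exists a. Qed.

Lemma quotient_field_dom (V : set K) (x : K) : dom `<=` V -> quotient_field V x.
Proof.
move=> domV; have [a [b [b0 ->]]] := fractionP x.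
exists (tofrac a); first exact/domV/dom_tofrac.
exists (tofrac b) => //; split; first exact/domV/dom_tofrac.
by move=> /eqP; rewrite tofrac_eq0 (negbTE b0).
Qed.

Lemma valuation_overring_dom (V : set K) :
  valuation_overring dom V <-> valring V /\ dom `<=` V.
Proof.
split=> [[[rV hV] domV _]|[[rV hV] domV]].
  do 2! split => //; move=> x; have [->|x0] := eqVneq x 0; first by left; apply: subring0.
  by apply: hV => //; apply: quotient_field_dom.
by split=> // x Vx; apply: quotient_field_dom.
Qed.

(** Any finite index type is allowed, so that sums and products of modules are generated by families
    over sum and product types; over ['I_n] it is [span]. *)
Definition gspan (T : finType) (g : T -> K) : set K :=
  [set x | exists2 a : T -> K, (forall t, dom (a t)) & x = \sum_t a t * g t].

Lemma gspan_fin_gen (T : finType) (g : T -> K) : fin_gen dom (gspan g).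
Proof.
exists #|T|, (fun i => g (enum_val i)); apply/seteqP; split => _ [a da ->].
  exists (fun i => a (enum_val i)) => //.
  by rewrite (reindex (@enum_val T predT)) //; apply/onW_bij/enum_val_bij.
exists (fun t => a (enum_rank t)) => //.
rewrite [RHS](reindex (@enum_val T predT)); last exact/onW_bij/enum_val_bij.
by apply: eq_bigr => i _; rewrite enum_valK.
Qed.

Lemma gspan_submodule (T : finType) (g : T -> K) : submodule dom (gspan g).
Proof.
have rD := dom_subring; split.
- exists (fun=> 0); first by move=> t; apply: subring0.
  by rewrite big1 // => t _; rewrite mul0r.
- move=> _ _ [a da ->] [b db ->]; exists (fun t => a t + b t).
    by move=> t; apply: subringD.
  by rewrite -big_split; apply: eq_bigr => t _; rewrite mulrDl.
- move=> r _ dr [a da ->]; exists (fun t => r * a t).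
    by move=> t; apply: subringM.
  by rewrite mulr_sumr; apply: eq_bigr => t _; rewrite mulrA.
Qed.

Lemma gspan_gen (T : finType) (g : T -> K) t : gspan g (g t).
Proof.
have rD := dom_subring; exists (fun s => (s == t)%:R).
  by move=> s; case: (_ == _); [apply: subring1|apply: subring0].
rewrite (bigD1 t) //= eqxx mul1r big1 ?addr0 // => s /negbTE ->.
by rewrite mul0r.
Qed.

Lemma gspan_sub (T : finType) (g : T -> K) (E : set K) :
  submodule dom E -> (forall t, E (g t)) -> gspan g `<=` E.
Proof.
move=> hE Eg _ [a da ->]; apply: (submodule_sum _ hE) => t.
by case: hE => _ _; apply.
Qed.

Lemma gspan_fD (T : finType) (g : T -> K) t : g t != 0 -> fD (gspan g).
Proof.
move=> g0; split; last exact: gspan_fin_gen.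
by split; [apply: gspan_submodule|exists (g t) => //; apply: gspan_gen].
Qed.

Lemma fD_gens (F : set K) : fD F -> exists n (g : 'I_n -> K), F = gspan g.
Proof. by case=> _ [n [g ->]]; exists n, g. Qed.

Lemma ideal_submodule (I : set K) : ideal dom I -> submodule dom I.
Proof. by case. Qed.

Lemma Fbar_dom : Fbar dom.
Proof.
split; first exact: subring_submodule dom_subring.
by exists 1; [apply: subring1 dom_subring|apply: oner_neq0].
Qed.

(** Finite generation enters here, both for chains in Zorn's lemma and for the modules [star G]
    whose union is [star_f star P]. *)
Lemma directed_finite (T : finType) (g : T -> K) (C : set (set K)) :
  C !=set0 -> (forall A B, C A -> C B -> exists2 E, C E & A `|` B `<=` E) ->
  (forall t, (\bigcup_(A in C) A) (g t)) -> exists2 A, C A & forall t, A (g t).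
Proof.
move=> [A0 CA0] dirC Cg.
suff [A CA Ag] : exists2 A, C A & forall t, t \in enum T -> A (g t).
  by exists A => // t; apply: Ag; rewrite mem_enum.
elim: (enum T) => [|t s [A CA Ag]]; first by exists A0.
have [B CB Bg] := Cg t; have [E CE sub] := dirC A B CA CB; exists E => // u.
by rewrite inE => /predU1P[->|/Ag Au]; apply: sub; [right|left].
Qed.

Variable star : set K -> set K.
Hypothesis hstar : semistar star.

Let starF E : Fbar E -> Fbar (star E). Proof. by case: hstar => h *; apply: h. Qed.
Let starZ x E : x != 0 -> Fbar E ->
  star [set x * y | y in E] = [set x * y | y in star E].
Proof. by case: hstar => _ h *; apply: h. Qed.
Let star_mono E F : Fbar E -> Fbar F -> E `<=` F -> star E `<=` star F.
Proof. by case: hstar => _ _ h *; apply: h. Qed.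
Let star_ext E : Fbar E -> E `<=` star E. Proof. by case: hstar => _ _ _ h *; apply: h. Qed.
Let star_idem E : Fbar E -> star (star E) = star E. Proof. by case: hstar => _ _ _ _ h *; apply: h. Qed.

Let star_sub E F : Fbar E -> Fbar F -> E `<=` star F -> star E `<=` star F.
Proof.
by move=> hE hF EF; rewrite -(star_idem hF); apply: star_mono => //; apply: starF.
Qed.

(** The condition that 1 is not in [star_f star J], spelled out. The zero ideal satisfies it
    vacuously, since members of [fD] are nonzero. *)
Definition star_proper (J : set K) : Prop := forall F, fD F -> F `<=` J -> ~ star F 1.

Lemma star_proper1 J : ideal dom J -> star_proper J -> ~ J 1.
Proof.
move=> hJ pJ J1; apply: (pJ (gspan (fun _ : 'I_1 => 1))).
- by apply: (gspan_fD (t := ord0)); apply: oner_neq0.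
- exact: gspan_sub (ideal_submodule hJ) _.
- apply: star_ext; last exact: (gspan_gen _ ord0).
  by case: (@gspan_fD _ (fun _ : 'I_1 => 1 : K) ord0 (oner_neq0 _)).
Qed.

Lemma fD_directed (E F G : set K) : submodule dom E -> fD F -> fD G ->
  F `<=` E -> G `<=` E -> exists2 H, fD H /\ H `<=` E & F `|` G `<=` H.
Proof.
move=> hE fF fG; have [[_ [x Fx x0]] _] := fF.
have [n [f def_F]] := fD_gens fF; have [m [g def_G]] := fD_gens fG => FE GE.
pose h (t : 'I_n + 'I_m) := match t with inl i => f i | inr j => g j end.
have FGh : F `|` G `<=` gspan h.
  rewrite def_F def_G => y [|]; apply: gspan_sub (@gspan_submodule _ h) _ y => i.
    exact: (gspan_gen h (inl i)).
  exact: (gspan_gen h (inr i)).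
exists (gspan h) => //; split.
  split; last exact: gspan_fin_gen.
  by split; [exact: gspan_submodule|exists x => //; apply: FGh; left].
apply: gspan_sub => // -[i|j] /=.
  by apply: FE; rewrite def_F; apply: gspan_gen.
by apply: GE; rewrite def_G; apply: gspan_gen.
Qed.

(** Zorn's lemma applies because a finitely generated module inside the union of a chain lies in one
    member. *)
Lemma exists_maximal_star_proper J : ideal dom J -> nonzero J -> star_proper J ->
  exists P, [/\ ideal dom P, J `<=` P, star_proper P &
    forall I, ideal dom I -> star_proper I -> P `<=` I -> I `<=` P].
Proof.
move=> hJ [x Jx x0] pJ.
pose good I := [/\ ideal dom I, J `<=` I & star_proper I].
have [|P [PU maxP]] := @Zorn_bigcup K [set I | I = set0 \/ good I].
  move=> F FP Ftot /=.
  have [[S [FS S0]]|noS] := pselect (exists S, F S /\ S <> set0); last first.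
    left; apply/seteqP; split => // y [S FS Sy]; apply: noS.
    by exists S; split => // S0; rewrite S0 in Sy.
  have FP' T y : F T -> T y -> good T.
    by move=> FT Ty; case: (FP T FT) => // T0; rewrite T0 in Ty.
  right; have [y Sy] : S !=set0 by apply/set0P/eqP.
  have [hS JS _] := FP' S y FS Sy.
  have dirF A B : F A -> F B -> exists2 E, F E & A `|` B `<=` E.
    move=> FA FB; case: (Ftot A B FA FB) => AB.
      by exists B => // u [/AB|].
    by exists A => // u [|/AB].
  split.
  - split; last by move=> u [T FT Tu]; have [[_ sub] _ _] := FP' T u FT Tu; apply: sub.
    split.
    + by exists S => //; case: (ideal_submodule hS).
    + move=> a b [A FA Aa] [B FB Bb]; have [E FE sub] := dirF A B FA FB.
      have Ea : E a by apply: sub; left.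
      have [hE _ _] := FP' E a FE Ea; exists E => //.
      by case: (ideal_submodule hE) => _ ED _; apply: ED => //; apply: sub; right.
    + move=> r a dr [A FA Aa]; exists A => //; have [hA _ _] := FP' A a FA Aa.
      by case: (ideal_submodule hA) => _ _; apply.
  - by move=> u Ju; exists S => //; apply: JS.
  - move=> G fG GF; have [n [g def_G]] := fD_gens fG.
    have [||t|A FA Ag] := @directed_finite _ g F.
    + by exists S.
    + exact: dirF.
    + by apply: GF; rewrite def_G; apply: gspan_gen.
    have [[_ [z Gz z0]] _] := fG.
    have [hA|A0] := pselect (A !=set0).
      have [u Au] := hA; have [iA _ pA] := FP' A u FA Au.
      by apply: pA => //; rewrite def_G; apply: gspan_sub (ideal_submodule iA) Ag.
    (* If the member found is empty, there are no generators at all, against [G] being nonzero. *)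
    case: n g def_G Ag => [|n] g def_G Ag; last by case: A0; exists (g ord0).
    by move: Gz; rewrite def_G => -[a _]; rewrite big_ord0 => z00; rewrite z00 eqxx in z0.
have gJ : good J by split.
have [hP JP pP] : good P.
  case: PU => // P0; case: (maxP J); last by right.
  by rewrite P0; split => // /(_ x Jx).
exists P; split => // I hI pI PI; apply: contrapT => NIP.
by apply: (maxP I); [split|right; split => //; apply: subset_trans PI].
Qed.

(** * Ideals maximal among those whose finite-type closure misses 1 *)

Section MaximalStarProper.
Variable P : set K.
Hypotheses (hP : ideal dom P) (P0 : nonzero P) (pP : star_proper P).
Hypothesis maxP : forall I, ideal dom I -> star_proper I -> P `<=` I -> I `<=` P.

Let sP : submodule dom P := ideal_submodule hP.

(** For [a] and [b] outside [P], maximality gives finitely generated [F] inside [P + aD] and [G]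
    inside [P + bD] whose closures contain 1. If [a * b] were in [P], the product [FG] would lie in
    [P] and its closure would contain 1. *)
Lemma maximal_star_proper_prime : prime_ideal dom P.
Proof.
have rD := dom_subring; have [P00 PD PM] := sP.
apply: prime_idealP => //; first exact: star_proper1.
have enlarge a : dom a -> ~ P a -> exists n (f : 'I_n -> K),
    [/\ fD (gspan f), star (gspan f) 1 &
        forall i, exists p r, [/\ P p, dom r & f i = p + r * a]].
  move=> da NPa; pose I := [set x | exists p r, [/\ P p, dom r & x = p + r * a]].
  have hI : ideal dom I.
    split; last first.
      by move=> _ [p [r [Pp dr ->]]]; apply: subringD => //; [case: hP => _; apply|apply: subringM].
    split; first by exists 0, 0; split => //; [apply: subring0|rewrite mul0r addr0].
      move=> _ _ [p [r [Pp dr ->]]] [p' [r' [Pp' dr' ->]]]; exists (p + p'), (r + r').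
      by split; [apply: PD|apply: subringD|rewrite mulrDl addrACA].
    move=> s _ ds [p [r [Pp dr ->]]]; exists (s * p), (s * r).
    by split; [apply: PM|apply: subringM|rewrite mulrDr mulrA].
  have PI : P `<=` I.
    by move=> p Pp; exists p, 0; split => //; [apply: subring0|rewrite mul0r addr0].
  have /existsNP[F /not_implyP[fF /not_implyP[FI /contrapT F1]]] : ~ star_proper I.
    move=> pI; apply: NPa; apply: (maxP hI pI PI).
    by exists 0, 1; split => //; [apply: subring1|rewrite mul1r add0r].
  have [n [f def_F]] := fD_gens fF; exists n, f; rewrite -def_F; split => // i.
  by apply: FI; rewrite def_F; apply: gspan_gen.
move=> a b da db Pab; apply: contrapT => /not_orP[NPa NPb].
have [n [f [fF F1 decF]]] := enlarge a da NPa.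
have [m [g [fG G1 decG]]] := enlarge b db NPb.
pose h (t : 'I_n * 'I_m) := f t.1 * g t.2.
have FGh x y : gspan f x -> gspan g y -> gspan h (x * y).
  move=> [c dc ->] [d dd ->]; exists (fun t => c t.1 * d t.2).
    by move=> t; apply: subringM.
  rewrite big_distrlr pair_bigA; apply: eq_bigr => -[i j] _ /=.
  by rewrite mulrACA.
have [FF FG] : Fbar (gspan f) /\ Fbar (gspan g) by case: fF; case: fG.
have fH : fD (gspan h).
  split; last exact: gspan_fin_gen.
  split; first exact: gspan_submodule.
  have [[_ [x Fx x0]] [_ [y Gy y0]]] := (FF, FG).
  by exists (x * y); [apply: FGh|rewrite mulf_neq0].
have FH : Fbar (gspan h) by case: fH.
apply: (pP fH).
  apply: gspan_sub => // -[i j]; rewrite /h /=.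
  have [p [r [Pp dr ->]]] := decF i; have [q [s [Pq ds ->]]] := decG j.
  have dPq : dom q by case: hP => _; apply.
  rewrite mulrDl mulrDr; apply: (PD); last rewrite mulrDr; do ?apply: (PD).
  - by rewrite mulrC; apply: PM.
  - by rewrite mulrC; apply: PM => //; apply: subringM.
  - by apply: PM => //; apply: subringM.
  - by rewrite mulrACA; apply: PM => //; apply: subringM.
(* It suffices that the closure of [FG] contains [G]: a nonzero [y] in [G] lies in [y] times the
   closure of [F], which is the closure of [yF]. *)
apply: (star_sub FG FH _ G1) => y Gy.
have [->|y0] := eqVneq y 0; first by case: (starF FH) => -[].
have Fy : Fbar [set y * x | x in gspan f].
  split; last first.
    by have [_ [x Fx x0]] := FF; exists (y * x); [exists x|rewrite mulf_neq0].
  have [[F0 FD FM] _] := FF; split; first by exists 0; rewrite ?mulr0.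
    by move=> _ _ [x Fx <-] [z Fz <-]; exists (x + z); [apply: FD|rewrite mulrDr].
  by move=> r _ dr [x Fx <-]; exists (r * x); [apply: FM|rewrite mulrCA].
apply: (star_mono Fy FH).
  by move=> _ [x Fx <-]; rewrite mulrC; apply: FGh.
by rewrite starZ //; exists 1; rewrite ?mulr1.
Qed.

(** The trace of [star_f star P] on [dom] is again a [star_proper] ideal, so it equals [P] by
    maximality; conversely, every proper quasi-ideal is [star_proper]. *)
Lemma maximal_star_proper_QMax : QMax (star_f star) P.
Proof.
have rD := dom_subring.
have [p0 Pp0 p00] := P0.
have P_starf : P `<=` star_f star P.
  (* The extra generator [p0] keeps the module nonzero when [x = 0]. *)
  move=> x Px; pose g (i : bool) := if i then p0 else x.
  have gg : fD (gspan g) by apply: (gspan_fD (t := true)).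
  exists (gspan g); last by apply: star_ext; [case: gg|apply: (gspan_gen g false)].
  by split => //; apply: gspan_sub => // -[].
have sub_G F : fD F -> F `<=` star_f star P -> exists2 G, fD G /\ G `<=` P & F `<=` star G.
  move=> fF FP; have [n [f def_F]] := fD_gens fF.
  have [||t|_ [G [fG GP] <-] fstar] :=
    @directed_finite _ f [set star G | G in [set G | fD G /\ G `<=` P]].
  - pose g (_ : 'I_1) := p0; exists (star (gspan g)), (gspan g) => //.
    by split; [apply: (gspan_fD (t := ord0))|apply: gspan_sub].
  - move=> _ _ [G [fG GP] <-] [H [fH HP] <-].
    have [E [fE EP] GHE] := fD_directed sP fG fH GP HP.
    exists (star E); first by exists E.
    have [[FG _] [FH _] [FE _]] := And3 fG fH fE.
    by move=> x [|]; apply: star_mono => // y ?; apply: GHE; [left|right].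
  - have [G [fG GP] Gt] : star_f star P (f t) by apply: FP; rewrite def_F; apply: gspan_gen.
    by exists (star G) => //; exists G.
  exists G => //; rewrite def_F; apply: gspan_sub fstar.
  by have [FG _] := fG; have [] := starF FG.
have closed_starf : star_f star P `&` dom = P.
  apply/seteqP; split; last by move=> x Px; split; [apply: P_starf|case: hP => _; apply].
  apply: maxP; last by move=> x Px; split; [apply: P_starf|case: hP => _; apply].
    split; last by move=> x [].
    have [P00 PD PM] := sP.
    split; first by split; [apply: P_starf|apply: subring0].
      move=> x y [[F [fF FP] Fx] dx] [[G [fG GP] Gy] dy]; split; last exact: subringD.
      have [H [fH HP] FGH] := fD_directed sP fF fG FP GP.
      have [[FF _] [FG _] [FH _]] := And3 fF fG fH.
      exists H => //; have [[_ HD _] _] := starF FH; apply: HD.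
        by apply: star_mono Fx => // z ?; apply: FGH; left.
      by apply: star_mono Gy => // z ?; apply: FGH; right.
    move=> r x dr [[F [fF FP] Fx] dx]; split; last exact: subringM.
    exists F => //; have [FF _] := fF; have [[_ _ FM] _] := starF FF.
    exact: FM.
  move=> F fF FP F1; have [G [fG GP] FG] := sub_G F fF (subset_trans FP (@subIsetl _ _ _)).
  apply: (pP fG GP); have [[FF _] [FG' _]] := (fF, fG).
  exact: (star_sub FF FG' FG).
split.
  split; first by split.
  by apply/eqP => PdD; apply: (star_proper1 hP pP); rewrite PdD; apply: subring1.
move=> J [[hJ J0 Jclosed] JD] PJ; apply/seteqP; split => //; apply: maxP => //.
move=> F fF FJ F1; case/eqP: JD; apply/seteqP; split; first by case: hJ.
have J1 : J 1.
  by rewrite -Jclosed; split; [exists F|apply: subring1].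
by move=> x dx; rewrite -[x]mulr1; case: (ideal_submodule hJ) => _ _; apply.
Qed.

End MaximalStarProper.

Lemma exists_star_center J : ideal dom J -> star_proper J ->
  exists P, [/\ prime_ideal dom P, J `<=` P &
    forall V, valring V -> localization dom P `<=` V ->
      star_valuation_overring (star_tilde star) V].
Proof.
move=> hJ pJ.
have rD := dom_subring.
have sub_loc P : prime_ideal dom P -> dom `<=` localization dom P.
  move=> hP x dx; exists x => //; exists 1; last by rewrite divr1.
  by split; [apply: subring1|apply: prime_proper1 hP].
have [J0|NJ0] := pselect (nonzero J); last first.
  have hP : prime_ideal dom [set 0].
    apply: prime_idealP => //=.
    - split; last by move=> _ ->; apply: subring0.
      by split => //= [_ _ -> ->|r _ _ ->]; rewrite ?addr0 ?mulr0.
    - by apply/eqP; apply: oner_neq0.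
    - by move=> x y _ _ /eqP; rewrite mulf_eq0 => /orP[] /eqP ->; [left|right].
  (* The zero ideal is never in [QMax], but its localization is [K]; hence [V = K], and [F V = K]
     for every nonzero [F]. *)
  exists [set 0]; split => //.
    by move=> x Jx; apply: contrapT => /eqP x0; apply: NJ0; exists x.
  move=> V hV locV; have domV := subset_trans (sub_loc _ hP) locV.
  split; first exact/valuation_overring_dom.
  move=> F [[_ [y Fy y0]] _] x _; exists 1%N, (fun=> y), (fun=> x / y).
  split => //; last by rewrite big_ord1 mulrC divfK.
  by move=> _; apply: locV; have := @quotient_field_dom dom (x / y) (@subset_refl _ _).
have [P [hP JP pP maxP]] := exists_maximal_star_proper hJ J0 pJ.
have P0 : nonzero P by have [x Jx x0] := J0; exists x => //; apply: JP.
have primeP := maximal_star_proper_prime hP pP maxP.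
exists P; split => // V hV locV.
have domV := subset_trans (sub_loc _ primeP) locV.
split; first exact/valuation_overring_dom.
move=> F _ x /(_ P (maximal_star_proper_QMax hP P0 pP maxP)) [n [a [b [Fa locb ->]]]].
by exists n, a, b; split => // i; apply: locV.
Qed.

(** No [P] in [QMax] contains the content of [g], so 1 lies in its tilde closure and hence in the
    content times [V]; this is impossible if all coefficients are nonunits. *)
Lemma N_star_unit_coef V g : star_valuation_overring (star_tilde star) V ->
  N_star star g -> exists i, ~ nonunits V (tofrac g`_i).
Proof.
move=> [/valuation_overring_dom [hV domV] tildeV] [g0 gstar].
apply: contrapT => /forallNP allN.
have {}allN i : nonunits V (tofrac g`_i) by apply: contrapT; apply: allN.
have rD := dom_subring; have rV := proj1 hV.
have fF : fD (content g).
  apply: (@gspan_fD 'I_(size g) _ (Ordinal (_ : (size g).-1 < size g)%N)).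
    by rewrite ltn_predL size_poly_gt0.
  by move=> sg; rewrite tofrac_eq0 /= -lead_coefE lead_coef_eq0.
have F1 : star (content g) 1.
  by rewrite gstar; apply: star_ext Fbar_dom _ _; apply: subring1.
have tilde1 : star_tilde star (content g) 1.
  move=> P [[[hP _ Pclosed] PD] _].
  have [i NPi] : exists i : 'I_(size g), ~ P (tofrac g`_i).
    apply: contrapT => /forallNP allP.
    case/eqP: PD; apply/seteqP; split; first by case: hP.
    have P1 : P 1.
      rewrite -Pclosed; split; last exact: subring1.
      exists (content g) => //; split => //.
      by apply: (gspan_sub (ideal_submodule hP)) => i; apply: contrapT; apply: allP.
    by move=> x dx; rewrite -[x]mulr1; case: (ideal_submodule hP) => _ _; apply.
  have gi0 : tofrac g`_i != 0.
    by apply/eqP => gi0; apply: NPi; rewrite gi0; case: (ideal_submodule hP).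
  exists 1%N, (fun=> tofrac g`_i), (fun=> 1 / tofrac g`_i); split.
  - by move=> _; apply: (gspan_gen (fun i : 'I_(size g) => tofrac g`_i)).
  - move=> _; exists 1; first exact: subring1.
    by exists (tofrac g`_i) => //; split => //; apply: dom_tofrac.
  - by rewrite big_ord1 div1r mulfV.
have [n [a [b [Fa Vb ab1]]]] := tildeV _ fF _ tilde1.
apply: (nonunits1 hV); rewrite ab1.
have [sM _] := nonunits_ideal hV; apply: (submodule_sum _ sM) => i.
rewrite mulrC; apply: nonunitsM => //.
have [c dc ->] := Fa i; elim/big_ind: _ => [|x y|j _]; [by left|exact: nonunitsD|].
by apply: nonunitsM => //; apply: domV.
Qed.

End SemistarCenters.

(** * Valuation overrings of the Nagata ring *)

Section NagataChains.
Variable D : idomainType.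
Local Notation K := {fraction D}.
Local Notation L := {fraction {poly D}}.
Local Notation dom := (@dom D).
Local Notation iota := (@frac_polyC D).
Local Notation X := (frac_X D).
Variable star : set K -> set K.
Hypothesis hstar : semistar star.

Lemma N_star1 : N_star star 1.
Proof.
split; first exact: oner_neq0.
have -> // : content 1 = dom.
have rD := dom_subring D; have sD := subring_submodule rD.
apply/seteqP; split; first by apply: gspan_sub sD _ => i; apply: dom_tofrac.
move=> x dx; exists (fun=> x) => //.
by rewrite -mulr_sumr size_poly1 big_ord1 coef1 tofrac1 mulr1.
Qed.

Lemma Na_tofrac f : Na star (tofrac f).
Proof. by exists f => //; exists 1; [exact: N_star1|rewrite tofrac1 divr1]. Qed.

Lemma quotient_field_Na (W : set L) (x : L) : Na star `<=` W -> quotient_field W x.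
Proof.
move=> NaW; have [f [g [g0 ->]]] := fractionP x.
exists (tofrac f); first exact/NaW/Na_tofrac.
exists (tofrac g) => //; split; first exact/NaW/Na_tofrac.
by move=> /eqP; rewrite tofrac_eq0 (negbTE g0).
Qed.

Lemma valuation_overring_Na (W : set L) :
  valuation_overring (Na star) W <-> valring W /\ Na star `<=` W.
Proof.
split=> [[[rW hW] NaW _]|[[rW hW] NaW]].
  do 2! split => //; move=> x; have [->|x0] := eqVneq x 0; first by left; apply: subring0.
  by apply: hW => //; apply: quotient_field_Na.
by split=> // x Wx; apply: quotient_field_Na.
Qed.

Lemma Nagata_chain_of_star_chain V n :
  star_valuation_overring (star_tilde star) V -> prime_chain V n ->
  exists W, valuation_overring (Na star) W /\ prime_chain W n.
Proof.
move=> hV chainV; have [/valuation_overring_dom [vV domV] _] := hV.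
have tr := @frac_X_transcendental D; have gen := @frac_X_generates D.
exists (gauss_ext iota X V); split; last exact: gauss_ext_prime_chain.
apply/valuation_overring_Na; split; first exact: gauss_ext_valring.
have Vcoef f : coefs_in V (map_poly (@tofrac D) f).
  by move=> i; rewrite coef_map; apply: domV; apply: dom_tofrac.
move=> _ [f _ [g Ng <-]].
exists (map_poly (@tofrac D) f), (map_poly (@tofrac D) g).
split; [exact: Vcoef| |by rewrite !eval_at_tofrac].
split; first exact: Vcoef.
by have [i Ni] := N_star_unit_coef hstar hV Ng; exists i; rewrite coef_map.
Qed.

(** * Descent from a valuation overring of the Nagata ring to [K] *)

Section Descent.
Variable W : set L.
Hypotheses (hW : valring W) (NaW : Na star `<=` W).

Let rW : is_subring W := proj1 hW.

Let Wtofrac f : W (tofrac f).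
Proof. exact/NaW/Na_tofrac. Qed.

Definition center_coefs : set K :=
  [set x | exists g i, nonunits W (tofrac g) /\ x = tofrac g`_i].

(** Multiplication by powers of X, which lie in [W], brings two coefficients to the same index, so
    their sum is again a single coefficient. *)
Lemma center_coefs_ideal : ideal dom center_coefs.
Proof.
split; last by move=> _ [g [i [_ ->]]]; apply: dom_tofrac.
split.
- by exists 0, 0%N; rewrite coef0 !tofrac0; split=> //; left.
- move=> _ _ [g [i [Mg ->]]] [h [j [Mh ->]]].
  exists (g * 'X^j + h * 'X^i), (i + j)%N; split.
    rewrite tofracD !tofracM; apply: nonunitsD => //.
      by rewrite mulrC; apply: nonunitsM.
    by rewrite mulrC; apply: nonunitsM.
  rewrite coefD !coefMXn ltnNge leq_addl /= addnK ltnNge leq_addr /= addKn.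
  by rewrite tofracD.
- move=> r _ /domP [a ->] [g [i [Mg ->]]]; exists (a%:P * g), i; split.
    by rewrite tofracM; apply: nonunitsM.
  by rewrite coefCM tofracM.
Qed.

(** Shifting the new polynomial by the size of the old one places their coefficients side by
    side. *)
Lemma center_coefs_common (s : seq K) : (forall x, x \in s -> center_coefs x) ->
  exists g, nonunits W (tofrac g) /\ forall x, x \in s -> exists i, x = tofrac g`_i.
Proof.
elim: s => [_|x s IH Js]; first by exists 0; split => //; left; rewrite tofrac0.
have [|g [Mg gs]] := IH; first by move=> y ys; apply: Js; rewrite inE ys orbT.
have [h [i [Mh def_x]]] := Js x (mem_head _ _).
exists (g + h * 'X^(size g)); split.
  rewrite tofracD tofracM; apply: nonunitsD => //.
  by rewrite mulrC; apply: nonunitsM.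
move=> y; rewrite inE => /predU1P[->|/gs[j def_y]].
  exists (i + size g)%N; rewrite coefD coefMXn ltnNge leq_addl /= addnK.
  by rewrite [g`__]nth_default ?leq_addl // add0r.
case: (ltnP j (size g)) => [ltj|gej].
  by exists j; rewrite coefD coefMXn ltj addr0.
(* A coefficient beyond the end of [g] is 0 and is read off beyond the end of the new polynomial. *)
exists (size (g + h * 'X^(size g))); rewrite def_y.
by rewrite (nth_default _ gej) nth_default.
Qed.

(** Some [g] in the center of [W] has content containing [F]. If the closure of [F] contained 1,
    then [g] would be in [N_star], hence a unit of [W]. *)
Lemma center_coefs_star_proper : star_proper star center_coefs.
Proof.
move=> F fF FJ F1; have [n [f def_F]] := fD_gens fF.
have [|g [Mg gf]] := @center_coefs_common [seq f i | i <- enum 'I_n].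
  by move=> _ /mapP[i _ ->]; apply: FJ; rewrite def_F; apply: gspan_gen.
pose c (i : 'I_(size g)) := tofrac g`_i.
have Fg : F `<=` content g.
  rewrite def_F; apply: (gspan_sub (gspan_submodule c)) => i.
  have [|j ->] := gf (f i); first by apply: map_f; rewrite mem_enum.
  case: (ltnP j (size g)) => [ltj|gej]; first exact: (gspan_gen c (Ordinal ltj)).
  by rewrite nth_default // tofrac0; case: (gspan_submodule c).
have [FF _] := fF; have [_ [x Fx x0]] := FF.
have Fc : Fbar (content g) by split; [exact: gspan_submodule|exists x => //; apply: Fg].
have g0 : g != 0.
  apply: contraNneq x0 => g0; have [a _ ->] := Fg x Fx.
  have gj0 j : g`_j = 0 by rewrite g0 coef0.
  by rewrite big1 // => i _; rewrite gj0 tofrac0 mulr0.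
case: (hstar) => starF _ star_mono _ star_idem.
have star1 : star (content g) 1 by apply: star_mono F1.
have [[_ _ cM] _] := starF _ Fc.
have Ng : N_star star g.
  split=> //; apply/seteqP; split.
    apply: star_mono => //; first exact: Fbar_dom.
    exact: (gspan_sub (subring_submodule (dom_subring D)) (fun i => dom_tofrac _)).
  rewrite -[X in _ `<=` X](star_idem _ Fc).
  apply: star_mono; [exact: Fbar_dom|exact: starF|].
  by move=> y dy; rewrite -[y]mulr1; apply: cM.
have : W (tofrac g)^-1 by apply: NaW; exists 1 => //; exists g; rewrite // tofrac1 div1r.
by case: Mg => // /eqP; rewrite tofrac_eq0 (negbTE g0).
Qed.

Lemma localization_subring P : prime_ideal dom P -> is_subring (localization dom P).
Proof.
move=> hP; have rD := dom_subring D.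
have nz s : ~ P s -> s != 0.
  by move=> NPs; apply/eqP => s0; apply: NPs; rewrite s0; apply: prime0 hP.
have NPM s t : dom s -> dom t -> ~ P s -> ~ P t -> ~ P (s * t).
  by move=> ds dt NPs NPt /(prime_mul hP ds dt) [].
apply: is_subringP.
- exists 1; first exact: subring1; exists 1; last by rewrite divr1.
  by split; [apply: subring1|apply: prime_proper1 hP].
- move=> _ _ [a da [s [ds NPs] <-]] [b db [t [dt NPt] <-]].
  exists (a * t - b * s); first by apply: subringB => //; apply: subringM.
  exists (s * t); first by split; [apply: subringM|apply: NPM].
  by rewrite -[in RHS]mulNr addf_div ?nz // mulNr.
- move=> _ _ [a da [s [ds NPs] <-]] [b db [t [dt NPt] <-]].
  exists (a * b); first exact: subringM.
  exists (s * t); first by split; [apply: subringM|apply: NPM].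
  by rewrite mulf_div.
Qed.

Definition local_plus_nonunits (P : set K) : set L :=
  [set x | exists d m, [/\ localization dom P d, nonunits W m & x = iota d + m]].

Section Center.
Variable P : set K.
Hypotheses (hP : prime_ideal dom P) (centerP : center_coefs `<=` P).

(** A nonunit constant [s] of [W] would be a coefficient of a polynomial in the center, hence in
    [P]; so the denominators are units of [W]. *)
Lemma localization_sub_W d : localization dom P d -> W (iota d).
Proof.
case=> _ /domP [a ->] [_ [/domP [s ->] NPs] <-].
have s0 : s != 0.
  by apply/eqP => s0; apply: NPs; rewrite s0 tofrac0; apply: prime0 hP.
rewrite frac_polyC_div //; apply: subringM => //.
have /not_orP[_ /contrapT //] : ~ nonunits W (tofrac s%:P).
move=> Ms; apply: NPs; apply: centerP; exists s%:P, 0%N; split => //.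
by rewrite coefC.
Qed.

Lemma local_plus_nonunits_subring : is_subring (local_plus_nonunits P).
Proof.
have rloc := localization_subring hP.
apply: is_subringP => [|_ _ [d [m [ld Mm ->]]] [e [k [le Mk ->]]]|
  _ _ [d [m [ld Mm ->]]] [e [k [le Mk ->]]]].
- by exists 1, 0; rewrite rmorph1 addr0; split => //; [apply: subring1|left].
- exists (d - e), (m - k); split; [exact: subringB| |by rewrite rmorphB opprD addrACA].
  apply: nonunitsD => //; rewrite -mulN1r; apply: nonunitsM => //.
  by apply: subringN => //; apply: subring1.
- exists (d * e), (iota d * k + (iota e * m + m * k)); split.
  + exact: subringM.
  + do ?[apply: nonunitsD => //]; apply: nonunitsM => //; try exact: localization_sub_W.
    exact: nonunitsS.
  + by rewrite rmorphM; ring.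
Qed.

(* Clearing denominators in [f(1/X) = X] gives a polynomial over [D] in the center of
   [W] with a coefficient outside [P]. *)
Lemma X_not_adjoin : ~ adjoin (local_plus_nonunits P) X^-1 X.
Proof.
move=> [f Rf fX]; have rD := dom_subring D.
have X0 : X != 0 by rewrite tofrac_eq0 polyX_eq0.
have /choice[dm hdm] i : exists dm : K * L,
    [/\ localization dom P dm.1, nonunits W dm.2 & f`_i = iota dm.1 + dm.2].
  by have [d [m [? ? ?]]] := Rf i; exists (d, m).
pose n := size f.
have [||i|s NPs hs] := @fraction_common_denominator D [set s | ~ P (tofrac s)] n
  (fun i => (dm i).1).
- by rewrite /= tofrac1; apply: prime_proper1 hP.
- move=> x y /= NPx NPy; rewrite tofracM => /(prime_mul hP) -[] //; exact: dom_tofrac.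
- have [[_ /domP [a ->] [_ [/domP [b ->] NPb] <-]] _ _] := hdm i.
  exists a, b; split => //; rewrite divfK //.
  by apply/eqP => b0; apply: NPb; rewrite b0; apply: prime0 hP.
have /choice[a ha] i : exists a, (i < n)%N -> (dm i).1 * tofrac s = tofrac a.
  by case: (ltnP i n) => [/hs[b hb]|_]; [exists b|exists 0].
(* Multiply [X = f(1/X)] by [s X^n] and collect the parts from [D_P] in [G]; what remains is in the
   maximal ideal of [W]. The sum has degree at most [n], so the coefficient of index [n + 1] is
   [s]. *)
pose G : {poly D} := s%:P * 'X^(n.+1) - \sum_(i < n) (a i)%:P * 'X^(n - i).
apply: NPs; apply: centerP; exists G, n.+1; split; last first.
  rewrite coefB coefCM coefXn eqxx mulr1 coef_sum big1 ?subr0 // => i _.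
  by rewrite coefCM coefXn gtn_eqF ?mulr0 // ltnS leq_subr.
have -> : tofrac G = \sum_(i < n) tofrac s%:P * X ^+ (n - i) * (dm i).2.
  have -> : tofrac G = tofrac s%:P * X ^+ n.+1
      - \sum_(i < n) tofrac (a i)%:P * X ^+ (n - i).
    rewrite tofracB tofracM rmorphXn; congr (_ - _); rewrite rmorph_sum.
    by apply: eq_bigr => i _; rewrite /= tofracM rmorphXn.
  rewrite exprSr -{2}fX horner_coef !mulr_sumr -sumrB; apply: eq_bigr => i _.
  have [_ _ ->] := hdm i.
  rewrite -(frac_polyC_tofrac (a i)) -ha // rmorphM /= frac_polyC_tofrac.
  have -> : X ^+ (n - i) = X ^+ n * X^-1 ^+ i.
    have le_in : (i <= n)%N := ltnW (ltn_ord i).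
    by rewrite exprVn -expfB_cond // (negbTE X0).
  by move: (X ^+ n) (X^-1 ^+ i) (iota _) => y z w; ring.
elim/big_ind: _ => [|x y|i _]; [by left|exact: nonunitsD|].
have [_ Mi _] := hdm i; apply: nonunitsM => //; apply: subringM => //.
by apply: subringX => //; apply: (Wtofrac 'X).
Qed.

(* The overring [U] of [W] has one more prime than [W], which pays for the prime
   that may be lost by restricting to [K]. *)
Lemma exists_restricted_chain n : prime_chain W n ->
  exists V, [/\ valring V, localization dom P `<=` V & prime_chain V n].
Proof.
move=> chainW; have rR := local_plus_nonunits_subring.
have [U [hU RU _ NUX]] := exists_valring_avoiding rR X_not_adjoin.
have rU := proj1 hU.
have MU : nonunits W `<=` U.
  move=> m Mm; apply: RU; exists 0, m; rewrite rmorph0 add0r; split => //.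
  exact: subring0 (localization_subring hP).
(* For [y] outside [W], [X / y] is a nonunit of [W], hence in [U]; then [y] in [U] would give [X] in
   [U]. *)
have UW : U `<=` W.
  move=> y Uy; apply: contrapT => NWy.
  have y0 : y != 0 by apply/eqP => y0; apply: NWy; rewrite y0; apply: subring0.
  apply: NUX; rewrite -[X](divfK y0); apply: subringM => //; apply: MU.
  by apply: nonunitsM => //; [apply: Wtofrac|right; rewrite invrK].
have chainU := prime_chain_subring hU MU UW (Wtofrac 'X) NUX chainW.
exists (iota @^-1` U); split.
- exact: restriction_valring.
- move=> d ld; apply: RU; exists d, 0; rewrite addr0; split => //; by left.
- exact: restriction_prime_chain (@frac_X_transcendental D) (@frac_X_generates D) _ hU _ chainU.
Qed.

End Center.

End Descent.

Lemma star_chain_of_Nagata_chain W n :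
  valuation_overring (Na star) W -> prime_chain W n ->
  exists V, star_valuation_overring (star_tilde star) V /\ prime_chain V n.
Proof.
move=> /valuation_overring_Na [hW NaW] chainW.
have [P [hP centerP tildeP]] := exists_star_center hstar
  (center_coefs_ideal hW NaW) (center_coefs_star_proper hW NaW).
have [V [hV locV chainV]] := exists_restricted_chain hW NaW hP centerP chainW.
by exists V; split => //; apply: tildeP.
Qed.

End NagataChains.

(** * Dimensions as suprema *)

(** The common form to which both dimensions are reduced, with [T] a set of lengths of prime
    chains. *)
Definition dim_sup (T : set nat) : \bar int := supremum 0%E [set dim_of_nat n | n in T].

Lemma dim_of_nat_le m n : (dim_of_nat m <= dim_of_nat n)%E = (m <= n)%N.
Proof. by rewrite /dim_of_nat lee_fin lez_nat. Qed.

Lemma supremum_eq (S : set (\bar int)) x : S !=set0 ->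
  supremums S x -> supremum 0%E S = x.
Proof.
move=> /set0P S0 [ubx lbx]; rewrite /supremum (negbTE S0).
apply: xget_unique => // y [uby lby]; apply/eqP; rewrite eq_le.
by rewrite lby // lbx.
Qed.

Lemma nat_set_max (T : set nat) : T !=set0 -> (exists N, forall n, T n -> (n <= N)%N) ->
  exists2 m, T m & forall n, T n -> (n <= m)%N.
Proof.
move=> [n0 Tn0] [N TN].
have ex : exists n, `[< T n >] by exists n0; apply/asboolP.
have ub n : `[< T n >] -> (n <= N)%N by move/asboolP/TN.
by case: (ex_maxnP ex ub) => m /asboolP Tm max_m; exists m => // n /asboolP /max_m.
Qed.

Lemma supremums_max (T : set nat) m : T m -> (forall n, T n -> (n <= m)%N) ->
  supremums [set dim_of_nat n | n in T] (dim_of_nat m).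
Proof.
move=> Tm max_m; split; first by move=> _ [n Tn <-]; rewrite dim_of_nat_le max_m.
by move=> y; apply; exists m.
Qed.

Lemma supremums_unbounded (T : set nat) : T !=set0 ->
  ~ (exists N, forall n, T n -> (n <= N)%N) ->
  supremums [set dim_of_nat n | n in T] +oo%E.
Proof.
move=> [n0 Tn0] unb; split; first by move=> y _; apply: leey.
move=> [z|//|] uby; last by have := uby _ (ex_intro2 _ _ n0 Tn0 erefl).
case: unb; exists `|z|%N => n Tn.
by have := uby _ (ex_intro2 _ _ n Tn erefl); rewrite /dim_of_nat lee_fin; lia.
Qed.

Lemma dim_sup_eq (T : set nat) x : T !=set0 ->
  supremums [set dim_of_nat n | n in T] x -> dim_sup T = x.
Proof. by move=> [n Tn]; apply: supremum_eq; exists (dim_of_nat n), n. Qed.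

Lemma dim_sup_supremums (T : set nat) : T !=set0 ->
  supremums [set dim_of_nat n | n in T] (dim_sup T).
Proof.
move=> T0; have [bnd|unb] := pselect (exists N, forall n, T n -> (n <= N)%N).
  have [m Tm max_m] := nat_set_max T0 bnd; have supT := supremums_max Tm max_m.
  by rewrite (dim_sup_eq T0 supT).
have supT := supremums_unbounded T0 unb.
by rewrite (dim_sup_eq T0 supT).
Qed.

Lemma valring_prime_chain0 (L : fieldType) (V : set L) : valring V -> prime_chain V 0.
Proof. by move=> hV; exists (fun=> nonunits V); split => // i _; apply: nonunits_prime. Qed.

Section KrullDim.
Variables (L : fieldType) (V : set L).
Hypothesis hV : valring V.

Let chain0 : prime_chain V !=set0.
Proof. by exists 0%N; apply: valring_prime_chain0. Qed.

Lemma prime_chain_le_krull_dim n : prime_chain V n -> (dim_of_nat n <= krull_dim V)%E.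
Proof. by move=> Vn; have [ub _] := dim_sup_supremums chain0; apply: ub; exists n. Qed.

Lemma krull_dim_le x : (forall n, prime_chain V n -> (dim_of_nat n <= x)%E) ->
  (krull_dim V <= x)%E.
Proof.
by move=> le_x; have [_ lb] := dim_sup_supremums chain0; apply: lb => _ [n Vn <-]; apply: le_x.
Qed.

End KrullDim.

(** A supremum of suprema is the supremum over the union of the sets of lengths. *)
Lemma valuative_dim_eq (L : fieldType) (R : set L) (T : set nat) :
  (forall W, valuation_overring R W -> valring W) -> T !=set0 ->
  (forall n, T n <-> exists W, valuation_overring R W /\ prime_chain W n) ->
  valuative_dim R = dim_sup T.
Proof.
move=> vW T0 defT; have [ubT lbT] := dim_sup_supremums T0.
apply: supremum_eq.
  by have [n /defT [W [hW _]]] := T0; exists (krull_dim W), W.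
split.
  move=> _ [W hW <-]; apply: krull_dim_le; first exact: vW.
  by move=> n Wn; apply: ubT; exists n => //; apply/defT; exists W.
move=> y uby; apply: lbT => _ [n /defT [W [hW Wn]] <-].
apply: le_trans (prime_chain_le_krull_dim (vW W hW) Wn) _.
by apply: uby; exists W.
Qed.

(** If [T] is bounded, its maximum is attained by a chain in some [V], whose dimension is then that
    maximum. If not, no integer qualifies and [xget] returns its default, infinity. *)
Lemma star_dimv_eq_dim_sup (D : idomainType) (star : set {fraction D} -> set {fraction D})
    (T : set nat) :
  T !=set0 ->
  (forall n, T n <-> exists V, star_valuation_overring star V /\ prime_chain V n) ->
  star_dimv star = dim_sup T.
Proof.
move=> T0 defT.
have vV V : star_valuation_overring star V -> valring V.
  by case=> /valuation_overring_dom [].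
have bound n : star_dimv_eq star n -> forall k, T k -> (k <= n)%N.
  move=> [le_n _] k /defT [V [hV Vk]]; rewrite -dim_of_nat_le.
  exact: le_trans (prime_chain_le_krull_dim (vV V hV) Vk) (le_n V hV).
have [bnd|unb] := pselect (exists N, forall n, T n -> (n <= N)%N); last first.
  rewrite (dim_sup_eq T0 (supremums_unbounded T0 unb)); apply: xgetPN => _ [n hn _].
  by apply: unb; exists n; apply: bound.
have [m Tm max_m] := nat_set_max T0 bnd; rewrite (dim_sup_eq T0 (supremums_max Tm max_m)).
have dim_m : star_dimv_eq star m.
  have le_m V : star_valuation_overring star V -> (krull_dim V <= dim_of_nat m)%E.
    move=> hV; apply: krull_dim_le (vV V hV) _ _ => n Vn.
    by rewrite dim_of_nat_le; apply: max_m; apply/defT; exists V.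
  split => //; have [V [hV Vm]] := (defT m).1 Tm; exists V => //.
  by apply/eqP; rewrite eq_le le_m //= prime_chain_le_krull_dim //; apply: vV.
apply: xget_unique; first by exists m.
move=> _ [n hn <-]; congr dim_of_nat; apply/eqP; rewrite eqn_leq.
rewrite (bound n hn) // andbT.
have [_ [V hV dimV]] := hn; rewrite -dim_of_nat_le -dimV.
by case: dim_m => le_m _; apply: le_m.
Qed.

Theorem theorem4p17 (D : idomainType)
    (star : set {fraction D} -> set {fraction D}) (hstar : @semistar D star) :
  @star_dimv D (@star_tilde D star) = @valuative_dim {fraction {poly D}} (@Na D star).
Proof.
pose T := [set n | exists V, star_valuation_overring (star_tilde star) V /\ prime_chain V n].
have T0 : T !=set0.
  have rD := dom_subring D.
  have triv : ideal (@dom D) [set 0].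
    split; last by move=> _ ->; apply: subring0.
    by split => //= [_ _ -> ->|r _ _ ->]; rewrite ?addr0 ?mulr0.
  (* The zero ideal serves only to obtain some prime [P]; as [K] contains every localization, [K]
     itself is a valuation overring for the tilde operation and 0 is in [T]. *)
  have [|P [_ _ tildeP]] := exists_star_center hstar triv.
    by move=> F [[_ [x Fx x0]] _] /(_ x Fx) /eqP; rewrite (negbTE x0).
  have vT : valring [set: {fraction D}] by split => [|x]; [apply: is_subringP|left].
  exists 0%N, setT; split; first exact: tildeP.
  exact: valring_prime_chain0.
rewrite (star_dimv_eq_dim_sup T0) // (@valuative_dim_eq _ _ T) //.
  by move=> W /valuation_overring_Na [].
move=> n; split => [[V [hV Vn]]|[W [hW Wn]]].
  exact: (Nagata_chain_of_star_chain hstar hV Vn).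
exact: (star_chain_of_Nagata_chain hstar hW Wn).
Qed.
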